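(* For $1\le i\le d$ let $(Y_i,d_i)$ be a compact metric space supporting a $g_i$-Ahlfors regular measure $\mathcal H^{g_i}$, with $g_i$ a doubling dimension function. For each $i$ let $f_i$ be a dimension function with $f_i\preceq g_i$, and assume that for distinct $i,j$ either $f_ig_j\preceq f_jg_i$ or $f_jg_i\preceq f_ig_j$. Assume that for each $i$, $\{E_{n,i}\}_{n\ge1}$ is a sequence of open subsets of $Y_i$ with $\limsup_{n\to\infty}E_{n,i}\in\mathscr G^{f_i}(Y_i)$. Let $\tilde f_i=g_1\cdots g_{i-1}f_ig_{i+1}\cdots g_d$. Then for each $i$, $Y_1\times\cdots\times Y_{i-1}\times(\limsup_{n\to\infty}E_{n,i})\times Y_{i+1}\times\cdots\times Y_d\in\mathscr G^{\tilde f_i}(\prod_{j=1}^dY_j)$. In particular, if $1\le k\le d$ is such that $\tilde f_k\preceq\tilde f_i$ for all $i$, then $(\limsup_nE_{n,1})\times\cdots\times(\limsup_nE_{n,d})\in\mathscr G^{\tilde f_k}(\prod_{j=1}^dY_j)$.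
   Context: The product $\prod_jY_j$ carries the metric $\max_jd_j$. A dimension function is a continuous nondecreasing $f:\mathbb R^+\to\mathbb R^+$ with $f(0)=0$; doubling: $f(2r)<Df(r)$ for some $D>1$. $\mathcal H^f_\eta(A)=\inf\{\sum_if(|B_i|):A\subset\bigcup_iB_i,\ B_i\text{ balls},|B_i|\le\eta\}$, $\mathcal H^f=\lim_{\eta\to0}\mathcal H^f_\eta$, $\mathcal H^f_\infty$ the Hausdorff $f$-content. $g$-Ahlfors regular: $\mathcal H^g(B(x,r))\asymp g(r)$ for all $x,r$. $h\preceq f$: $r\mapsto h(r)/f(r)$ monotonic and $\lim_{r\to0}h(r)/f(r)>0$. For a metric space $Z$, $\mathscr G^f(Z)$ is the class of $G_\delta$ sets $A\subset Z$ for which there is $c>0$ with $\mathcal H^f_\infty(A\cap B)>c\,\mathcal H^f_\infty(B)$ for all balls $B\subset Z$. *)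

(* Defs.v *)
From HB Require Import structures.
From mathcomp Require Import all_boot all_order all_algebra.
From mathcomp Require Import all_classical all_reals all_analysis borel_hierarchy.

Set Implicit Arguments.
Unset Strict Implicit.
Unset Printing Implicit Defensive.

Import Order.TTheory GRing.Theory Num.Theory.
Import numFieldTopology.Exports numFieldNormedType.Exports.

Local Open Scope classical_set_scope.
Local Open Scope ring_scope.

(* An alias of the dependent product: the library's own (countable) product
   pseudometric is not the max metric. *)
Definition max_prod (R : realType) (d : nat) (Y : 'I_d -> metricType R) : Type :=
  forall i, Y i.

Section MaxProd.
Context (R : realType) (d : nat) (Y : 'I_d -> metricType R).

HB.instance Definition _ := gen_eqMixin (max_prod Y).
HB.instance Definition _ := gen_choiceMixin (max_prod Y).

Definition max_dist (x y : max_prod Y) : R :=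
  \big[Num.max/0]_(i < d) mdist (x i) (y i).

Lemma max_dist_ge0 x y : 0 <= max_dist x y.
Proof. exact: bigmax_ge_id. Qed.

Lemma mdist_le_max_dist x y i : mdist (x i) (y i) <= max_dist x y.
Proof. exact: (le_bigmax_cond 0 (fun i => mdist (x i) (y i))). Qed.

Lemma max_distxx x : max_dist x x = 0.
Proof.
apply/eqP; rewrite eq_le max_dist_ge0 andbT.
by apply: bigmax_le => // i _; rewrite mdistxx.
Qed.

Lemma max_dist_positivity x y : max_dist x y = 0 -> x = y.
Proof.
move=> xy0; apply: functional_extensionality_dep => i.
apply: mdist_positivity; apply/eqP.
by rewrite eq_le mdist_ge0 andbT -xy0 mdist_le_max_dist.
Qed.

Lemma max_dist_sym x y : max_dist x y = max_dist y x.
Proof. by apply: eq_bigr => i _; exact: metric_sym. Qed.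

Lemma max_dist_triangle y x z : max_dist x z <= max_dist x y + max_dist y z.
Proof.
apply: bigmax_le => [|i _]; first by rewrite addr_ge0 ?max_dist_ge0.
by rewrite (le_trans (metric_triangle _ (y i) _))// lerD// mdist_le_max_dist.
Qed.

HB.instance Definition _ := @isMetric.Build R (max_prod Y) max_dist
  max_distxx max_dist_positivity max_dist_sym max_dist_triangle.

End MaxProd.

Section DimensionFunctions.
Context {R : realType}.
Implicit Types f h : R -> R.

(* Functions on [0, +oo[ are encoded as functions on R whose values at negative
   arguments are irrelevant. *)
Definition dimension_function f : Prop :=
  [/\ {within `[0, +oo[, continuous f},
      {in `[0, +oo[ &, {homo f : r s / r <= s}},
      forall r, 0 <= r -> 0 <= f r
    & f 0 = 0].

(* At r = 0 the strict inequality would read 0 < 0. *)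
Definition doubling f : Prop :=
  exists2 D : R, 1 < D & forall r, 0 < r -> f (2 * r) < D * f r.

(* The limit is taken in the extended reals: the case l = +oo is allowed. *)
Definition dim_le h f : Prop :=
  ({in `]0, +oo[ &, {homo (fun r => h r / f r) : r s / r <= s}} \/
   {in `]0, +oo[ &, {homo (fun r => h r / f r) : r s / r <= s >-> s <= r}}) /\
  exists2 l : \bar R, (0 < l)%E & (h r / f r)%:E @[r --> 0^'+] --> l.

End DimensionFunctions.

Section Hausdorff.
Context {R : realType} {Z : metricType R}.
Implicit Types (f g : R -> R) (A B : set Z).

(* [sup] is 0 on the empty set and on unbounded sets; below, [diam] is only
   applied to bounded sets. *)
Definition diam A : R := sup [set mdist x.1 x.2 | x in A `*` A].

Definition is_ball B : Prop := exists x r, 0 < r /\ B = ball x r.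

(* The value set0 is allowed so that finite covers are included; it contributes
   f 0 to the sum. *)
Definition ball_cover (eta : \bar R) A (B : (set Z)^nat) : Prop :=
  [/\ forall i, B i = set0 \/ is_ball (B i),
      forall i, ((diam (B i))%:E <= eta)%E
    & A `<=` \bigcup_i B i].

Definition hausdorff_pre f (eta : \bar R) A : \bar R :=
  ereal_inf [set (\sum_(0 <= i <oo) (f (diam (B i)))%:E)%E
            | B in ball_cover eta A].

Definition hausdorff_measure f A : \bar R :=
  lim (hausdorff_pre f eta%:E A @[eta --> 0^'+]).

Definition hausdorff_content f A : \bar R := hausdorff_pre f +oo%E A.

(* On a bounded space the balls of radius larger than the diameter are the whole
   space, so the comparison is only meaningful for r <= diam Z. *)
Definition ahlfors_regular g : Prop :=
  exists2 C : R, 0 < C & forall (x : Z) r, 0 < r <= diam [set: Z] ->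
    ((C^-1 * g r)%:E <= hausdorff_measure g (ball x r) <= (C * g r)%:E)%E.

Definition large_class f A : Prop :=
  Gdelta A /\
  exists2 c : R, 0 < c & forall B, is_ball B ->
    (c%:E * hausdorff_content f B < hausdorff_content f (A `&` B))%E.

End Hausdorff.

Arguments ahlfors_regular {R} Z g.
Arguments large_class {R} Z f A.

Definition tilde (R : realType) (d : nat) (f g : 'I_d -> R -> R) (i : 'I_d)
    (r : R) : R :=
  \prod_(j < d) (if j == i then f j r else g j r).

(* Main.v *)
(* Idea. Call U "large" if H^f_oo(U `&` B(x,r)) >= c f(r) for all small r.

   Products: a cover of pi_i^-1(A) `&` B by balls B_k restricts, on each slice
   obtained by fixing the coordinates j <> i at z, to a cover of A `&` B(x_i,r),
   so the f_i(diam B_k) of the balls hitting the slice add up to at least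
   c f_i(r).  Averaging over z with the Ahlfors regular measures (realised here
   by counting points of fine nets, which only needs compactness) turns this
   into sum_k f~_i(diam B_k) >= c' f~_i(r).

   Intersections: countable intersections of open large sets U_n, with the same
   c, are large by a Baire category argument.  Given a family of balls C_k with
   sum f(diam C_k) < e f(r), one finds inside U_n `&` B(x,r) a smaller ball
   B(y,t) such that the C_k meeting it satisfy sum f(diam C_k) < e f(t).  If no
   such ball existed, then at every point of U_n outside the enlarged C_k all
   small balls would carry a proportion of f coming from the tail of the family,
   and Vitali's covering lemma would show that these points have content zero;
   so U_n `&` B(x,r/2) would have content at most C e f(r), which is too small.
   The nested balls shrink to a point of the intersection outside all C_k.

   Since f~_k <= f~_i in the order of dimension functions, sets that are large
   for f~_i are large for f~_k, and the second part is obtained by intersecting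
   the open sets {y | y_i in \bigcup_(n >= N) E_(n,i)}. *)
Require Import Defs.
From HB Require Import structures.
From mathcomp Require Import all_boot all_order all_algebra.
From mathcomp Require Import all_classical all_reals all_analysis borel_hierarchy.
From mathcomp Require Import ring lra.

Set Implicit Arguments.
Unset Strict Implicit.
Unset Printing Implicit Defensive.

Import Order.TTheory GRing.Theory Num.Theory.
Import numFieldTopology.Exports numFieldNormedType.Exports.

Local Open Scope classical_set_scope.
Local Open Scope ring_scope.

(* The library's [is_ball], about subsets of the real line, shadows the one used here. *)
Local Notation is_ball := Defs.is_ball.

(** * Metric spaces, gauges and Hausdorff content *)

Lemma compact_ascending {T : topologicalType} (K : set T) (W : (set T)^nat) :
  compact K -> (forall n, open (W n)) ->
  (forall m n, (m <= n)%N -> W m `<=` W n) -> K `<=` \bigcup_n W n ->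
  exists n, K `<=` W n.
Proof.
move=> cK oW ndW KW; apply/not_existsP => KnW.
pose F := filter_from [set: nat] (fun n => K `\` W n).
have FF : ProperFilter F.
  apply: filter_from_proper => [|n _]; last first.
    by have /existsNP[x /not_implyP[Kx nWx]] := KnW n; exists x.
  apply: filter_from_filter => [|m n _ _]; first by exists 0%N.
  exists (maxn m n) => // x [Kx nWx]; split; split=> // Wx; apply: nWx.
    by apply: ndW Wx; exact: leq_maxl.
  by apply: ndW Wx; exact: leq_maxr.
have [p [Kp clFp]] : K `&` cluster F !=set0.
  by apply: cK; exists 0%N => // x [].
have [n _ Wnp] := KW p Kp.
have [|x [[_ nWx] Wx]] := clFp (K `\` W n) (W n) _ (open_nbhs_nbhs (conj (oW n) Wnp)).
  by exists n.
exact: nWx.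
Qed.

Section MetricSpaces.
Context {R : realType} {X : metricType R}.
Implicit Types (x y z : X) (A B : set X) (r s t : R).

Lemma mball x r y : ball x r y <-> mdist x y < r.
Proof. by rewrite ballEmdist. Qed.

Lemma mball_center x r : 0 < r -> ball x r x.
Proof. by move=> r0; apply/mball; rewrite mdistxx. Qed.

Lemma sub_mball x y r s : mdist x y + s <= r -> ball y s `<=` ball x r.
Proof.
move=> xysr z /mball yz; apply/mball.
by rewrite (le_lt_trans (metric_triangle _ y _))//; lra.
Qed.

Lemma mball_open x r : open (ball x r).
Proof.
rewrite openE => y /mball xy; apply/nbhs_ballP.
exists (r - mdist x y) => /=; first by rewrite subr_gt0.
by apply: sub_mball; rewrite addrC subrK.
Qed.

Lemma compact_mdist_bounded : compact [set: X] ->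
  exists2 L, 0 < L & forall x y, mdist x y <= L.
Proof.
move=> cX; have [[x0 _]|X0] := pselect (exists x : X, True); last first.
  by exists 1 => // x; exfalso; apply: X0; exists x.
have [||x _|n Xn] := compact_ascending cX (W := fun n => ball x0 n%:R).
- by move=> n; exact: mball_open.
- by move=> m n mn; apply: sub_mball; rewrite mdistxx add0r ler_nat.
- by exists (Num.truncn (mdist x0 x)).+1 => //; apply/mball; rewrite truncnS_gt.
exists (n%:R + n%:R + 1) => [|x y]; first by rewrite ltr_wpDl.
rewrite (le_trans (metric_triangle _ x0 _))// metric_sym.
by have /mball := Xn x Logic.I; have /mball := Xn y Logic.I; lra.
Qed.

Lemma diam_le A t : 0 <= t -> (forall x y, A x -> A y -> mdist x y <= t) ->
  diam A <= t.
Proof.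
move=> t0 At; rewrite /diam.
have [->|/set0P[[x y] [/= Ax Ay]]] := eqVneq (A `*` A) set0.
  by rewrite image_set0 sup0.
apply: ge_sup; first by exists (mdist x y), (x, y).
by move=> _ [[a b] [/= Aa Ab] <-]; exact: At.
Qed.

Section BoundedSpace.
Context {L : R} (bddX : forall x y, mdist x y <= L).

Lemma mdist_le_diam A x y : A x -> A y -> mdist x y <= diam A.
Proof.
move=> Ax Ay; apply: ub_le_sup; last by exists (x, y).
by exists L => _ [[a b] _ <-] /=.
Qed.

Lemma diam_ge0 A : 0 <= diam A.
Proof.
have [->|/set0P[x Ax]] := eqVneq A set0.
  by rewrite /diam set0X image_set0 sup0.
by have := mdist_le_diam Ax Ax; rewrite mdistxx.
Qed.

Lemma le_diam A B : A `<=` B -> diam A <= diam B.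
Proof.
by move=> AB; apply: diam_le (diam_ge0 _) _ => x y /AB Bx /AB; exact: mdist_le_diam.
Qed.

End BoundedSpace.

Lemma diam0 : diam (set0 : set X) = 0.
Proof. by rewrite /diam set0X image_set0 sup0. Qed.

Lemma diam_ball x r : 0 <= r -> diam (ball x r) <= 2 * r.
Proof.
move=> r0; apply: diam_le; first by rewrite mulr_ge0.
move=> y z /mball xy /mball xz.
rewrite (le_trans (metric_triangle _ x _))// metric_sym.
by lra.
Qed.

End MetricSpaces.

Section Gauges.
Context {R : realType}.
Implicit Types f g : R -> R.

Definition pregauge f : Prop :=
  [/\ forall r : R, 0 < r -> 0 < f r, 0 <= f 0,
      forall r s : R, 0 <= r -> r <= s -> f r <= f s
    & forall L : R, exists2 D : R, 0 < D &
        forall r : R, 0 < r <= L -> f (2 * r) <= D * f r].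

Definition gauge f : Prop :=
  [/\ pregauge f, f 0 = 0 &
      forall e : R, 0 < e -> exists2 t : R, 0 < t & f t < e].

Lemma pregauge_ge0 f r : pregauge f -> 0 <= r -> 0 <= f r.
Proof.
by move=> [fp f0 _ _]; rewrite le_eqVlt => /orP[/eqP<-//|/fp/ltW].
Qed.

Lemma pregauge_gt0 f r : pregauge f -> 0 < r -> 0 < f r.
Proof. by move=> [+ _ _ _]; exact. Qed.

Lemma pregauge_le f r s : pregauge f -> 0 <= r -> r <= s -> f r <= f s.
Proof. by move=> [_ _ + _]; exact. Qed.

Lemma pregauge_doubling f n L : pregauge f ->
  exists2 D : R, 0 < D & forall r : R, 0 < r <= L -> f (2 ^+ n * r) <= D * f r.
Proof.
move=> gf; elim: n => [|n [D D0 IH]].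
  by exists 1 => // r _; rewrite expr0 !mul1r.
have [_ _ _ /(_ (2 ^+ n * L))[D' D'0 fD']] := gf.
exists (D' * D) => [|r /andP[r0 rL]]; first exact: mulr_gt0.
rewrite exprS -mulrA (le_trans (fD' _ _))//.
  by rewrite mulr_gt0 ?exprn_gt0//= ler_pM2l ?exprn_gt0.
by rewrite -mulrA ler_pM2l// IH// r0.
Qed.

Lemma pregauge1 : pregauge (fun=> 1).
Proof. by split=> // L; exists 1 => // r _; rewrite mulr1. Qed.

Lemma pregaugeM f g : pregauge f -> pregauge g -> pregauge (fun r => f r * g r).
Proof.
move=> gf gg; split.
- by move=> r r0; rewrite mulr_gt0// pregauge_gt0.
- by rewrite mulr_ge0// pregauge_ge0.
- move=> r s r0 rs; have s0 := le_trans r0 rs.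
  by rewrite ler_pM ?pregauge_ge0// pregauge_le.
- move=> L; have [_ _ _ /(_ L)[D D0 fD]] := gf.
  have [_ _ _ /(_ L)[D' D'0 gD']] := gg.
  exists (D * D') => [|r /andP[r0 rL]]; first exact: mulr_gt0.
  have r20 : 0 <= 2 * r by rewrite mulr_ge0// ltW.
  rewrite (_ : _ * _ * _ = (D * f r) * (D' * g r)); last by ring.
  by apply: ler_pM; [exact: pregauge_ge0|exact: pregauge_ge0|rewrite fD ?r0|rewrite gD' ?r0].
Qed.

Lemma gaugeM f g : gauge f -> pregauge g -> gauge (fun r => f r * g r).
Proof.
move=> [gf f0 fv] gg; split; first exact: pregaugeM.
  by rewrite f0 mul0r.
move=> e e0; have g1 : 0 < g 1 by exact: pregauge_gt0.
have [t t0 ft] := fv (e / g 1) (divr_gt0 e0 g1).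
exists (Num.min t 1); first by rewrite lt_min t0 /=.
have m0 : 0 <= Num.min t 1 by rewrite le_min (ltW t0) ler01.
have : f (Num.min t 1) * g (Num.min t 1) <= f t * g 1.
  apply: ler_pM; [exact: pregauge_ge0|exact: pregauge_ge0|..].
    by rewrite pregauge_le// ge_min lexx.
  by rewrite pregauge_le// ge_min lexx orbT.
by move=> /le_lt_trans; apply; rewrite -ltr_pdivlMr.
Qed.

End Gauges.

Section Content.
Context {R : realType} {X : metricType R} {L : R}.
Hypothesis bddX : forall x y : X, mdist x y <= L.
Implicit Types (A B : set X) (f : R -> R) (C : (set X)^nat).

Definition ball_family C : Prop := forall i, C i = set0 \/ is_ball (C i).

Lemma ball_is_ball (x : X) r : 0 < r -> is_ball (ball x r).
Proof. by move=> r0; exists x, r. Qed.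

Lemma le_content f A C : ball_family C -> A `<=` \bigcup_i C i ->
  (hausdorff_content f A <= \sum_(0 <= i <oo) (f (diam (C i)))%:E)%E.
Proof.
move=> CB AC; apply: ereal_inf_lbound; exists C => //.
by split=> // i; exact: leey.
Qed.

Lemma content_ge f A (T : \bar R) :
  (forall C, ball_family C -> A `<=` \bigcup_i C i ->
    (T <= \sum_(0 <= i <oo) (f (diam (C i)))%:E)%E) ->
  (T <= hausdorff_content f A)%E.
Proof. by move=> H; apply: le_ereal_inf_tmp => _ [C [CB _ AC] <-]; exact: H. Qed.

Lemma content_lt f A (T : \bar R) : (hausdorff_content f A < T)%E ->
  exists C, [/\ ball_family C, A `<=` \bigcup_i C i &
    (\sum_(0 <= i <oo) (f (diam (C i)))%:E < T)%E].
Proof.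
move=> /ereal_inf_lt[_ [C [CB _ AC] <-]] CT.
by exists C.
Qed.

Lemma content_mono f A B : A `<=` B ->
  (hausdorff_content f A <= hausdorff_content f B)%E.
Proof.
by move=> AB; apply: content_ge => C CB BC; apply: le_content => // x /AB/BC.
Qed.

Lemma fdiam_ge0 f A : pregauge f -> (0 <= (f (diam A))%:E)%E.
Proof. by move=> gf; rewrite lee_fin pregauge_ge0// (diam_ge0 bddX). Qed.

Lemma content_ge0 f A : pregauge f -> (0 <= hausdorff_content f A)%E.
Proof.
by move=> gf; apply: content_ge => C _ _; apply: nneseries_ge0 => i _ _; exact: fdiam_ge0.
Qed.

Lemma le_content_countable f A (I : choiceType) (D : set I) (C : I -> set X) :
  gauge f -> countable D -> (forall i, D i -> is_ball (C i)) ->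
  A `<=` \bigcup_(i in D) C i ->
  (hausdorff_content f A <= \esum_(i in D) (f (diam (C i)))%:E)%E.
Proof.
move=> [gf f0 _] /countable_injP[h hD] CB AC.
pose C' n := [set x | exists i, [/\ D i, h i = n & C i x]].
have C'E i : D i -> C' (h i) = C i.
  move=> Di; apply/seteqP; split => [x [j [Dj ji Cjx]]|x Cix]; last by exists i.
  by rewrite -(hD _ _ _ _ ji) ?inE.
have C'B : ball_family C'.
  move=> n; have [[i Di <-]|hn] := pselect (exists2 i, D i & h i = n).
    by right; rewrite C'E//; exact: CB.
  by left; apply/seteqP; split => // x [i [Di ein _]]; apply: hn; exists i.
apply: (le_trans (le_content f C'B _)).
  by move=> x /AC[i Di Cix]; exists (h i) => //; exists i.
rewrite nneseries_esumT; last by move=> n; exact: fdiam_ge0.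
rewrite [leRHS](_ : _ = \esum_(i in D) (f (diam (C' (h i))))%:E)%E; last first.
  by apply: eq_esum => i Di; rewrite C'E.
rewrite -(@esum_image _ _ _ D h (fun n => (f (diam (C' n)))%:E))//.
rewrite [leRHS]esum_mkcond; apply: le_esum => n _.
case: ifPn => // /negP hDn.
rewrite (_ : C' n = set0) ?diam0 ?f0//.
apply/seteqP; split => // x [i [Di ein _]]; apply: hDn.
by rewrite inE; exists i.
Qed.

Lemma contentU f A B : gauge f ->
  (hausdorff_content f (A `|` B) <=
   hausdorff_content f A + hausdorff_content f B)%E.
Proof.
move=> gf; have [pf f0 _] := gf; apply/lee_addgt0Pr => e e0.
have [->|fA] := eqVneq (hausdorff_content f A) +oo%E.
  by rewrite addye ?leey// gt_eqF// (lt_le_trans (ltNyr 0))// content_ge0.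
have [->|fB] := eqVneq (hausdorff_content f B) +oo%E.
  by rewrite addey ?leey// gt_eqF// (lt_le_trans (ltNyr 0))// content_ge0.
have finA : hausdorff_content f A \is a fin_num.
  by rewrite ge0_fin_numE ?content_ge0// ltey.
have finB : hausdorff_content f B \is a fin_num.
  by rewrite ge0_fin_numE ?content_ge0// ltey.
have e20 : 0 < e / 2 by rewrite divr_gt0.
have [C [CB AC sC]] : exists C, [/\ ball_family C, A `<=` \bigcup_i C i &
    (\sum_(0 <= i <oo) (f (diam (C i)))%:E < hausdorff_content f A + (e / 2)%:E)%E].
  by apply: content_lt; rewrite lteDl// lte_fin.
have [C' [CB' AC' sC']] : exists C, [/\ ball_family C, B `<=` \bigcup_i C i &
    (\sum_(0 <= i <oo) (f (diam (C i)))%:E < hausdorff_content f B + (e / 2)%:E)%E].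
  by apply: content_lt; rewrite lteDl// lte_fin.
pose E (n : nat) := if odd n then C' n./2 else C n./2.
have EB : ball_family E by move=> n; rewrite /E; case: ifP.
apply: (le_trans (le_content f EB _)).
  move=> x [/AC[n _ Cnx]|/AC'[n _ Cnx]].
    by exists n.*2 => //; rewrite /E odd_double doubleK.
  by exists n.*2.+1 => //; rewrite /E /= odd_double /= uphalf_double.
have ge0 n : (0 <= (f (diam (E n)))%:E)%E by exact: fdiam_ge0.
rewrite nneseries_esumT//.
rewrite (esumID [set n | odd n])// !setTI.
have -> : [set n | odd n] = (fun n => n.*2.+1) @` setT.
  apply/seteqP; split => [n /= on|_ [n _ <-]]; last by rewrite /= odd_double.
  by exists n./2 => //; rewrite -[RHS]odd_double_half on.
have -> : ~` ((fun n => n.*2.+1) @` setT) = double @` setT.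
  apply/seteqP; split => [n /= on|_ [n _ <-] [m _ /(congr1 odd)]] /=.
    have /negbTE on' : ~~ odd n.
      apply/negP => on'; apply: on.
      by exists n./2 => //; rewrite -[RHS]odd_double_half on'.
    by exists n./2 => //; rewrite -[RHS]odd_double_half on'.
  by rewrite !odd_double.
rewrite !esum_image; last 2 first.
- by move=> m n _ _; exact: double_inj.
- by move=> m n _ _ [] /double_inj.
rewrite -!nneseries_esumT//.
rewrite [X in (_ <= X)%E](_ : _ =
  (hausdorff_content f B + (e / 2)%:E) + (hausdorff_content f A + (e / 2)%:E))%E; last first.
  by rewrite addeACA -EFinD -splitr (addeC (hausdorff_content f A)).
apply: leeD; apply: ltW.
- rewrite (eq_eseriesr (g := fun n => (f (diam (C' n)))%:E))// => n _.
  by rewrite /E /= odd_double /= uphalf_double.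
- rewrite (eq_eseriesr (g := fun n => (f (diam (C n)))%:E))// => n _.
  by rewrite /E odd_double doubleK.
Qed.

Lemma content_diam f B : gauge f -> is_ball B ->
  (hausdorff_content f B <= (f (diam B))%:E)%E.
Proof.
move=> gf Bb.
have := @le_content_countable f B unit [set tt] (fun=> B) gf.
rewrite esum_set1; last by apply: fdiam_ge0; case: gf.
by apply => // x Bx; exists tt.
Qed.

End Content.

(** * Intersections of open sets of large content *)

Lemma vitali_metric {R : realType} {X : metricType R} (A : set X) (t : X -> R) r :
  (forall x, A x -> 0 < t x <= r) ->
  exists D : set X, [/\ D `<=` A,
    forall y z, D y -> D z -> y != z -> t y + t z <= mdist y z &
    forall x, A x -> exists2 y, D y & mdist x y < t x + t y /\ t x <= 2 * t y].
Proof.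
move=> At.
pose P (D : set X) := [/\ D `<=` A,
  forall y z, D y -> D z -> y != z -> t y + t z <= mdist y z &
  forall x y, A x -> D y -> mdist x y < t x + t y ->
    exists2 y, D y & mdist x y < t x + t y /\ t x <= 2 * t y].
have [F FP totF|D [[DA Dsep Dnear] maxD]] := @Zorn_bigcup _ P.
  split.
  - by move=> x [D /FP[DA _ _] Dx]; exact: DA.
  - move=> y z [D FD Dy] [E FE Ez].
    have [DE|ED] := totF D E FD FE.
      by have [_ + _] := FP _ FE; apply => //; exact: DE.
    by have [_ + _] := FP _ FD; apply => //; exact: ED.
  - move=> x y Ax [D FD Dy] xy.
    have [_ _ /(_ x y Ax Dy xy)[z Dz zP]] := FP _ FD.
    by exists z => //; exists D.
exists D; split => // x Ax; apply: contrapT => xD.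
pose A' := [set x | A x /\ forall y, D y -> ~ mdist x y < t x + t y].
have A'x : A' x.
  by split => // y Dy xy; apply: xD; exact: Dnear Dy xy.
have [x0 A'x0 max0] : exists2 x0, A' x0 & forall x, A' x -> t x <= 2 * t x0.
  have ubA' : ubound [set t y | y in A'] r.
    by move=> _ [y [Ay _] <-]; have /andP[] := At y Ay.
  have le_sup y : A' y -> t y <= sup [set t y | y in A'].
    by move=> A'y; apply: ub_le_sup; [exists r|exists y].
  have [||_ [x0 A'x0 <-] x0P] := @sup_gt _ [set t y | y in A'] (sup [set t y | y in A'] / 2).
  - by exists (t x), x.
  - have := le_sup x A'x; have /andP[] := At x Ax; lra.
  - by exists x0 => // y /le_sup; lra.
have [Ax0 x0D] := A'x0.
have nDx0 : ~ D x0.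
  move=> /x0D; apply; rewrite mdistxx.
  by have /andP[x00 _] := At x0 Ax0; rewrite addr_gt0.
apply: (maxD (D `|` [set x0])).
  by split => [z Dz|D0]; [left|apply: nDx0; apply: D0; right].
split.
- by move=> z [/DA//|->].
- move=> y z [Dy|->] [Dz|->] yz.
  + exact: Dsep.
  + by rewrite addrC metric_sym leNgt; apply/negP/x0D.
  + by rewrite leNgt; apply/negP/x0D.
  + by rewrite eqxx in yz.
- move=> z y Az Dy zy.
  have [[y' Dy' zy']|zD] := pselect (exists2 y', D y' & mdist z y' < t z + t y').
    by have [w Dw wP] := Dnear z y' Az Dy' zy'; exists w => //; left.
  have A'z : A' z by split => // w Dw zw; apply: zD; exists w.
  exists x0; first by right.
  split; last exact: max0.
  by case: Dy zy => [Dy zy|->//]; exfalso; apply: zD; exists y.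
Qed.

Lemma nested_closed_balls {R : realType} {X : metricType R}
    (x : nat -> X) (t : nat -> R) :
  compact [set: X] -> (forall n, 0 <= t n) ->
  (forall n z, mdist (x n.+1) z <= t n.+1 -> mdist (x n) z <= t n) ->
  exists z, forall n, mdist (x n) z <= t n.
Proof.
move=> cX t0 nest; apply/not_existsP => H.
have nestS m n : (m <= n)%N -> forall z, mdist (x n) z <= t n -> mdist (x m) z <= t m.
  move=> /subnK <-; elim: (n - m)%N => [//|k IH] z kz.
  by apply: IH; exact: nest.
have [| | |n] := compact_ascending cX (W := fun n => [set z | t n < mdist (x n) z]).
- move=> n; rewrite openE => z /= tz; apply/nbhs_ballP.
  exists (mdist (x n) z - t n) => /=; first by rewrite subr_gt0.
  move=> w /mball zw /=; have := metric_triangle (x n) w z.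
  by rewrite (metric_sym w); lra.
- move=> m n mn z /=; apply: contraTT; rewrite -!leNgt; exact: nestS.
- move=> z _; have /existsNP[n nz] := H z.
  by exists n => //=; rewrite ltNge; apply/negP.
by move=> /(_ (x n) Logic.I) /=; rewrite mdistxx ltNge t0.
Qed.

Lemma subset_esum {R : realType} {I : choiceType} (D E : set I) (a : I -> \bar R) :
  D `<=` E -> (\esum_(i in D) a i <= \esum_(i in E) a i)%E.
Proof.
move=> DE; apply: le_ereal_sup => _ [F [finF FD] <-].
by exists F => //; split => //; exact: subset_trans FD DE.
Qed.

Lemma le_esumZl {R : realType} {I : choiceType} (D : set I) (a : I -> \bar R)
    (c : R) : 0 <= c -> (forall i, 0 <= a i)%E ->
  (\esum_(i in D) (c%:E * a i) <= c%:E * \esum_(i in D) a i)%E.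
Proof.
move=> c0 a0; apply: ge_ereal_sup => _ [F [finF FD] <-].
rewrite -ge0_mule_fsumr// lee_wpmul2l ?lee_fin//.
by apply: ereal_sup_ubound; exists F.
Qed.

Lemma esum_tail {R : realType} (J : set nat) (a : nat -> \bar R) (e : R) :
  (forall n, 0 <= a n)%E -> (\esum_(n in J) a n < +oo)%E -> 0 < e ->
  exists k, (\esum_(n in J `&` [set n | (k <= n)%N]) a n < e%:E)%E.
Proof.
move=> a0 Joo e0; pose u n := (if n \in J then a n else 0)%E.
have u0 n : (0 <= u n)%E by rewrite /u; case: ifP.
have uoo : (\sum_(0 <= n <oo) u n < +oo)%E.
  by rewrite nneseries_esumT// -esum_mkcond.
have [|k _ kP] := nneseries_tail_cvg uoo (fun n _ => u0 n) (t := [set x | (x < e%:E)%E]).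
  by apply: open_nbhs_nbhs; split; [exact: open_ereal_lt_ereal|rewrite /= lte_fin].
exists k; have := kP k (leqnn k).
by rewrite /= eseries_cond nneseries_esum// -esum_mkcondl.
Qed.

Lemma esum_disjoint_le {R : realType} {I K : choiceType} (D : set I)
    (G : I -> set K) (E : set K) (a : K -> \bar R) :
  (forall k, 0 <= a k)%E -> (forall i, D i -> G i `<=` E) ->
  (forall i j k, D i -> D j -> G i k -> G j k -> i = j) ->
  (\esum_(i in D) \esum_(k in G i) a k <= \esum_(k in E) a k)%E.
Proof.
move=> a0 GE Ginj; rewrite esum_esum//.
rewrite -(@esum_image _ _ _ (D `*`` G) snd a); last first.
  move=> [i k] [j l] /set_mem[/= Di Gik] /set_mem[/= Dj Gjl] /= kl.
  by move: Gik; rewrite kl => /(Ginj i j l Di Dj)/(_ Gjl) ->.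
by apply: subset_esum => _ [[i k] [/= Di Gik] <-]; exact: GE Gik.
Qed.

Section LargeIntersections.
Context {R : realType} {X : metricType R} {L : R}.
Hypothesis bddX : forall x y : X, mdist x y <= L.
Variable f : R -> R.
Hypothesis gf : gauge f.

Let pf : pregauge f. Proof. by case: gf. Qed.

Definition large_in (c r0 : R) (U : set X) : Prop := forall (x : X) r, 0 < r <= r0 ->
  ((c * f r)%:E <= hausdorff_content f (U `&` ball x r))%E.

Definition hit_mass (C : (set X)^nat) (A : set X) : \bar R :=
  (\esum_(i in [set i | C i `&` A !=set0]) (f (diam (C i)))%:E)%E.

Lemma large_in_diam_gt0 c r0 U (x : X) r : 0 < c -> 0 < r0 -> large_in c r0 U ->
  0 < r -> 0 < diam (ball x r).
Proof.
move=> c0 r00 lU rgt0.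
pose s := Num.min r r0.
have s0 : 0 < s by rewrite lt_min rgt0.
have : 0 < diam (ball x s).
  rewrite lt_neqAle (diam_ge0 bddX) andbT; apply/eqP => d0.
  have := lU x s; rewrite s0 ge_min lexx orbT => /(_ isT).
  apply/negP; rewrite -ltNge.
  apply: (@le_lt_trans _ _ (f (diam (ball x s)))%:E).
    apply: le_trans _ (content_diam bddX gf (ball_is_ball x s0)).
    by apply: content_mono => z [].
  have [_ f0 _] := gf.
  by rewrite -d0 f0 lte_fin mulr_gt0// pregauge_gt0.
move=> /lt_le_trans; apply; apply: (le_diam bddX).
by apply: sub_mball; rewrite mdistxx add0r ge_min lexx.
Qed.

(* The enlargements N i of the C i that meet ball x r have small total content;
   a point of U outside them only meets, in a ball of radius t, sets C i of
   diameter less than t, hence of large index, and a Vitali covering by such balls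
   bounds the content of these points by a tail of the convergent series. *)
Lemma large_in_step c r0 : 0 < c -> 0 < r0 -> exists2 e : R, 0 < e &
  forall (U : set X) C (x : X) r, open U -> large_in c r0 U -> ball_family C ->
  0 < r <= r0 -> (hit_mass C (ball x r) < (e * f r)%:E)%E ->
  exists y t, [/\ 0 < t <= r / 2,
    forall z, mdist y z <= t -> U z /\ ball x r z &
    (hit_mass C (ball y t) < (e * f t)%:E)%E].
Proof.
move=> c0 r00.
have [D1 D10 fD1] := pregauge_doubling 1 r0 pf.
have [D2 D20 fD2] := pregauge_doubling 2 L pf.
have [D4 D40 fD4] := pregauge_doubling 4 r0 pf.
pose e := c / (2 * D1 * D2).
have e0 : 0 < e by rewrite divr_gt0// !mulr_gt0.
exists e => // U C x r oU lU CB /andP[rgt0 rr0] mass_lt.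
apply: contrapT => nogood.
have bad y t : 0 < t <= r / 2 -> (forall z, mdist y z <= t -> U z /\ ball x r z) ->
    ((e * f t)%:E <= hit_mass C (ball y t))%E.
  by move=> tr ty; rewrite leNgt; apply/negP => lt; apply: nogood; exists y, t.
have fd0 i : (0 <= (f (diam (C i)))%:E)%E by exact: (fdiam_ge0 bddX).
have [_ f0 _] := gf.
pose I := [set i | C i `&` ball x r !=set0].
have dC i : C i !=set0 -> 0 < diam (C i).
  move=> [z]; have [->//|[a [s [s0 ->]]] _] := CB i.
  exact: large_in_diam_gt0 lU s0.
pose N i := [set z | exists2 b, C i b & mdist b z < diam (C i)].
pose A := U `&` ball x (r / 2).
pose A1 := A `&` \bigcup_(i in I) N i.
pose A2 := A `\` \bigcup_(i in I) N i.
have r20 : 0 < r / 2 by rewrite divr_gt0.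
have HA1 : (hausdorff_content f A1 <= D2%:E * hit_mass C (ball x r))%E.
  have /choice[b bP] : forall i, exists b, I i -> C i b.
    by move=> i; have [[b [Cb _]]|] := pselect (I i); [exists b|exists x].
  apply: (@le_trans _ _ (\esum_(i in I) (f (diam (ball (b i) (2 * diam (C i)))))%:E)%E).
    apply: (le_content_countable bddX gf) => [|i Ii|z [_ [i Ii [w Cw wz]]]].
    - exact: countableP.
    - by apply: ball_is_ball; rewrite mulr_gt0// dC//; exists (b i); exact: bP.
    exists i => //; apply/mball; rewrite (le_lt_trans (metric_triangle _ w _))//.
    by have := mdist_le_diam bddX (bP i Ii) Cw; lra.
  apply: le_trans _ (le_esumZl _ _ fd0); last exact: ltW.
  apply: le_esum => i Ii; rewrite lee_fin.
  have d0 : 0 < diam (C i) by apply: dC; exists (b i); exact: bP.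
  have dL : diam (C i) <= L.
    by apply: diam_le => //; exact: le_trans (mdist_ge0 x x) _.
  apply: le_trans _ (fD2 _ _); last by rewrite d0.
  rewrite pregauge_le//; first exact: diam_ge0 bddX _.
  rewrite (le_trans (diam_ball _ _))//; first by rewrite mulr_ge0 ?ltW.
  by rewrite mulrA -expr2.
have HA2 tau : 0 < tau -> (hausdorff_content f A2 <= tau%:E)%E.
  move=> tau0; have tau'0 : 0 < tau * e / D4 by apply: divr_gt0 => //; exact: mulr_gt0.
  have [|k tailk] := esum_tail fd0 _ tau'0 (J := I).
    by apply: lt_le_trans mass_lt _; exact: leey.
  have /choice[t tP] : forall y, exists t, A2 y -> [/\ 0 < t <= r / 4,
      forall z, mdist y z <= t -> U z /\ ball x r z &
      forall i, (i < k)%N -> I i -> t <= diam (C i)].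
    move=> y; have [[[Uy /mball xy] _]|] := pselect (A2 y); last by exists 0.
    have /nbhs_ballP[s /= s0 sU] : nbhs y U by exact: open_nbhs_nbhs.
    have [t' t'0 t'P] : exists2 t' : R, 0 < t' &
        forall i, (i < k)%N -> I i -> t' <= diam (C i).
      elim: (k) => [|n [t' t'0 IH]]; first by exists 1.
      have [In|nIn] := pselect (I n); last first.
        by exists t' => // i; rewrite ltnS leq_eqVlt => /predU1P[->//|]; exact: IH.
      exists (Num.min t' (diam (C n))).
        by rewrite lt_min t'0 dC//; have [z [Cz _]] := In; exists z.
      move=> i; rewrite ltnS leq_eqVlt => /predU1P[-> _|/IH{}IH /IH].
        by rewrite ge_min lexx orbT.
      by rewrite ge_min => ->.
    exists (Num.min (Num.min (r / 4) (s / 2)) t') => _; split.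
    - by rewrite !lt_min !divr_gt0//= t'0 !ge_min lexx.
    - move=> z; rewrite !le_min => /andP[/andP[yz1 yz2] _]; split.
        by apply: sU; apply/mball; rewrite (le_lt_trans yz2)//; lra.
      by apply/mball; rewrite (le_lt_trans (metric_triangle _ y _))//; lra.
    - by move=> i ik /(t'P i ik); rewrite ge_min orbC => ->.
  have [y A2y|D [DA2 Dsep Dnear]] := @vitali_metric _ _ A2 (fun y => 2 * t y) r.
    by have [/andP[t0 tr] _ _] := tP y A2y; apply/andP; split; lra.
  pose G y := [set i | C i `&` ball y (t y) !=set0].
  have Gsmall y i : D y -> G y i ->
      [/\ I i, (k <= i)%N & exists2 b, C i b & diam (C i) <= mdist y b < t y].
    move=> /DA2 A2y [b [Cb /mball yb]]; have [t0 tyU tk] := tP y A2y.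
    have Ii : I i by exists b; split=> //; have [] := tyU b (ltW yb).
    have db : diam (C i) <= mdist y b.
      rewrite leNgt; apply/negP => lt; case: A2y => _; apply.
      by exists i => //; exists b => //; rewrite metric_sym.
    split => //; last by exists b; rewrite ?db.
    by rewrite leqNgt; apply/negP => /tk/(_ Ii); have := le_lt_trans db yb; lra.
  have Ginj y z i : D y -> D z -> G y i -> G z i -> y = z.
    move=> Dy Dz /(Gsmall y i Dy)[_ _ [b Cb /andP[ib yb]]].
    move=> /(Gsmall z i Dz)[_ _ [b' Cb' /andP[ib' zb']]].
    apply: contrapT => /eqP/(Dsep y z Dy Dz).
    have := metric_triangle y b z; have := metric_triangle b b' z.
    have := mdist_le_diam bddX Cb Cb'; have := diam_ge0 bddX (C i).
    by rewrite (metric_sym b'); lra.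
  have t0 y : D y -> 0 < t y by move=> /DA2/tP[/andP[]].
  have tr y : D y -> t y <= r / 4 by move=> /DA2/tP[/andP[]].
  have massy y : D y -> ((e * f (t y))%:E <= hit_mass C (ball y (t y)))%E.
    move=> Dy; have [_ tyU _] := tP y (DA2 y Dy).
    by apply: bad => //; rewrite t0//=; have := tr y Dy; lra.
  have cD : countable D.
    have /choice[h hP] : forall y, exists i, D y -> G y i.
      move=> y; have [Dy|] := pselect (D y); last by exists 0%N.
      suff /set0P[i Gi] : G y != set0 by exists i.
      apply/eqP => Gy0; have := massy y Dy.
      rewrite /hit_mass -/(G y) Gy0 esum_set0 lee_fin leNgt mulr_gt0//.
      exact: pregauge_gt0 (t0 y Dy).
    apply/countable_injP; exists h => y z /set_mem Dy /set_mem Dz hyz.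
    by apply: (Ginj y z (h y)) => //; [|rewrite hyz]; exact: hP.
  apply: (@le_trans _ _ (\esum_(y in D) (f (diam (ball y (6 * t y))))%:E)%E).
    apply: (le_content_countable bddX gf) => // [y Dy|z A2z].
      by apply: ball_is_ball; rewrite mulr_gt0// t0.
    have [y Dy [zy tzy]] := Dnear z A2z.
    by exists y => //; apply/mball; rewrite metric_sym; lra.
  apply: (@le_trans _ _ (\esum_(y in D) ((D4 / e)%:E * hit_mass C (ball y (t y))))%E).
    apply: le_esum => y Dy; apply: (@le_trans _ _ (D4 * f (t y))%:E).
      rewrite lee_fin; apply: le_trans _ (fD4 _ _); last first.
        by rewrite t0//=; have := tr y Dy; lra.
      rewrite pregauge_le//; first exact: diam_ge0 bddX _.
      rewrite (le_trans (diam_ball _ _))//; first by rewrite mulr_ge0// ltW// t0.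
      have := t0 y Dy; rewrite (_ : 2 ^+ 4 = 16); last by ring.
      lra.
    have -> : (D4 * f (t y))%:E = ((D4 / e)%:E * (e * f (t y))%:E)%E.
      by rewrite -EFinM; congr EFin; field; rewrite gt_eqF.
    by apply: lee_wpmul2l; [rewrite lee_fin divr_ge0 ?ltW|exact: massy].
  apply: le_trans (le_esumZl _ _ _) _ => [|y|].
  - by rewrite divr_ge0 ?ltW.
  - by apply: esum_ge0 => i _; exact: fd0.
  have -> : tau%:E = ((D4 / e)%:E * (tau * e / D4)%:E)%E.
    by rewrite -EFinM; congr EFin; field; rewrite !gt_eqF.
  apply: lee_wpmul2l; first by rewrite lee_fin divr_ge0 ?ltW.
  apply: le_trans _ (ltW tailk); apply: esum_disjoint_le => //.
  by move=> y Dy i /(Gsmall y i Dy)[].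
have HA : ((c * f (r / 2))%:E <= hausdorff_content f A)%E.
  by apply: lU; rewrite r20/=; lra.
have : (hausdorff_content f A <= hausdorff_content f A1 + hausdorff_content f A2)%E.
  apply: le_trans _ (contentU bddX _ _ gf); apply: content_mono => z Az.
  by have [zN|zN] := pselect ((\bigcup_(i in I) N i) z); [left|right].
have fr0 : 0 < f r by exact: pregauge_gt0.
have tau0 : 0 < c * f r / (4 * D1) by rewrite divr_gt0 ?mulr_gt0.
have : (hausdorff_content f A1 <= (D2 * (e * f r))%:E)%E.
  apply: le_trans HA1 _; rewrite [leRHS]EFinM.
  by apply: lee_wpmul2l; [rewrite lee_fin ltW|exact: ltW].
have := HA2 _ tau0 => H2 H1 H; have := le_trans HA (le_trans H (leeD H1 H2)).
rewrite -EFinD lee_fin.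
have : f r <= D1 * f (r / 2).
  have -> : f r = f (2 ^+ 1 * (r / 2)) by congr f; rewrite expr1; field.
  by apply: fD1; rewrite r20/=; lra.
rewrite -ler_pdivrMl// => fr2.
apply/negP; rewrite -ltNge.
have /lt_le_trans -> // : D2 * (e * f r) + c * f r / (4 * D1) < c * (D1^-1 * f r).
rewrite /e.
have -> : D2 * (c / (2 * D1 * D2) * f r) + c * f r / (4 * D1) =
   (3 / 4) * (c * (D1^-1 * f r)) by field; rewrite !gt_eqF.
by rewrite gtr_pMl ?mulr_gt0 ?invr_gt0//; lra.
by rewrite ler_pM2l.
Qed.

Lemma large_in_bigcap c r0 : compact [set: X] -> 0 < c -> 0 < r0 ->
  exists2 e : R, 0 < e & forall U : (set X)^nat, (forall n, open (U n)) ->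
    (forall n, large_in c r0 (U n)) -> large_in e r0 (\bigcap_n U n).
Proof.
move=> cX c0 r00; have [e e0 step] := large_in_step c0 r00.
exists e => // U oU lU x r /andP[rgt0 rr0]; rewrite leNgt; apply/negP.
move=> /content_lt[C [CB CU Clt]].
have [_ f0 fv] := gf.
have fd0 i : (0 <= (f (diam (C i)))%:E)%E by exact: (fdiam_ge0 bddX).
pose good (p : nat * (X * R)) := 0 < p.2.2 <= r0 /\
  (hit_mass C (ball p.2.1 p.2.2) < (e * f p.2.2)%:E)%E.
have /choice[F FP] : forall p, exists q, good p -> [/\ good q, q.1 = p.1.+1,
    q.2.2 <= p.2.2 / 2 &
    forall z, mdist q.2.1 z <= q.2.2 -> U p.1 z /\ ball p.2.1 p.2.2 z].
  move=> [n [y t]]; have [[/= tr mass_lt]|] := pselect (good (n, (y, t))); last first.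
    by exists (n, (y, t)).
  have [y' [t' [/andP[t'0 t't] t'U mass_lt']]] := step _ _ _ _ (oU n) (lU n) CB tr mass_lt.
  exists (n.+1, (y', t')) => _; split => //; split => //=.
  by rewrite t'0/=; lra.
pose p n := iter n F (0%N, (x, r)).
have goodp n : good (p n) /\ (p n).1 = n.
  elim: n => [|n [gn pn]]; last by have [gF Fn _ _] := FP _ gn; rewrite /= Fn pn.
  split => //; split; first by rewrite /= rgt0.
  apply: le_lt_trans Clt; rewrite nneseries_esumT//; exact: subset_esum.
pose y n := (p n).2.1; pose t n := (p n).2.2.
have t0 n : 0 < t n by have [[/andP[]]] := goodp n.
have tS n : t n.+1 <= t n / 2 by have [/FP[]] := goodp n.
have yS n z : mdist (y n.+1) z <= t n.+1 -> U n z /\ ball (y n) (t n) z.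
  by have [gn pn] := goodp n; have [_ _ _ /(_ z)] := FP _ gn; rewrite pn.
have [z zP] : exists z, forall n, mdist (y n) z <= t n.
  apply: nested_closed_balls => // [n|n z /yS[_ /mball/ltW//]].
  exact: ltW.
have [i _ Ciz] : (\bigcup_i C i) z.
  apply: CU; split => [n _|]; first by have [] := yS n z (zP n.+1).
  by have [] := yS 0%N z (zP 1%N).
have di : 0 < diam (C i).
  have [Ci0|[a [s [s0 ->]]]] := CB i; first by move: Ciz; rewrite Ci0.
  exact: large_in_diam_gt0 (lU 0%N) s0.
have fi0 : 0 < f (diam (C i)) by exact: pregauge_gt0.
have [s s0 fs] := fv (f (diam (C i)) / e) (divr_gt0 fi0 e0).
have [n tn] : exists n, t n <= s.
  have tn n : t n <= r / n.+1%:R.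
    elim: n => [|n IH]; first by rewrite divr1.
    apply: le_trans (tS n) _; rewrite ler_pdivlMr//.
    move: IH; rewrite ler_pdivlMr// => IH; apply: le_trans _ IH.
    rewrite -mulrA ler_pM2l// ler_pdivrMl// -natrM ler_nat mul2n -addnn.
    by rewrite addnS addSn ltnS leq_addr.
  exists (Num.truncn (r / s)); apply: le_trans (tn _) _.
  by rewrite ler_pdivrMr// mulrC -ler_pdivrMr// ltW// truncnS_gt.
have [[_ mass_lt] _] := goodp n.
have : (\esum_(j in [set i]) (f (diam (C j)))%:E < (e * f (t n))%:E)%E.
  apply: le_lt_trans mass_lt; apply: subset_esum => _ ->.
  by exists z; split => //; have [] := yS n z (zP n.+1).
rewrite esum_set1// lte_fin => /lt_le_trans.
move=> /(_ _ (ler_wpM2l (ltW e0) (pregauge_le pf (ltW (t0 n)) tn))).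
by rewrite mulrC -ltr_pdivrMr// => /lt_trans/(_ fs); rewrite ltxx.
Qed.

End LargeIntersections.

(** * Counting in Ahlfors regular spaces *)

Section HausdorffMeasure.
Context {R : realType} {X : metricType R}.
Implicit Types (A : set X) (f : R -> R).

Lemma hausdorff_pre_nonincreasing f A :
  {in `]0, +oo[%R &, nonincreasing_fun (fun eta : R => hausdorff_pre f eta%:E A)}.
Proof.
move=> e e' _ _ ee'; apply: ereal_inf_le_tmp => _ [B [Bb Be AB] <-].
by exists B => //; split => // i; apply: le_trans (Be i) _; rewrite lee_fin.
Qed.

Lemma hausdorff_measureE f A : hausdorff_measure f A =
  ereal_sup ((fun eta : R => hausdorff_pre f eta%:E A) @` [set` `]0, +oo[%R]).
Proof.
apply/cvg_lim => //; apply: nonincreasing_at_right_cvge => //.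
exact: hausdorff_pre_nonincreasing.
Qed.

Lemma hausdorff_pre_le_measure f A (eta : R) : 0 < eta ->
  (hausdorff_pre f eta%:E A <= hausdorff_measure f A)%E.
Proof.
move=> eta0; rewrite hausdorff_measureE; apply: ereal_sup_ubound.
by exists eta => //=; rewrite in_itv/= eta0.
Qed.

Lemma lt_hausdorff_measure f A a : (a < hausdorff_measure f A)%E ->
  \forall eta \near (0 : R)^'+, (a < hausdorff_pre f eta%:E A)%E.
Proof.
rewrite hausdorff_measureE => /ereal_sup_gt[_ [eta /= + <-] a_lt].
rewrite in_itv/= andbT => eta0; near=> e.
apply: lt_le_trans a_lt _; apply: hausdorff_pre_nonincreasing.
- by rewrite in_itv/= andbT; near: e; exact: nbhs_right_gt.
- by rewrite in_itv/= eta0.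
- by near: e; exact: nbhs_right_le.
Unshelve. all: by end_near. Qed.

End HausdorffMeasure.

Lemma esum_seq {R : realType} {I : choiceType} (s : seq I) (a : I -> \bar R) :
  uniq s -> (forall i, 0 <= a i)%E ->
  (\esum_(i in [set` s]) a i = \sum_(i <- s) a i)%E.
Proof.
move=> us a0; by rewrite esum_fset//; exact/esym/fsbig_seq.
Qed.

Section AhlforsCounting.
Context {R : realType} {X : metricType R} {L : R}.
Hypothesis bddX : forall x y : X, mdist x y <= L.
Variable g : R -> R.
Hypothesis gg : gauge g.
Hypothesis Xregular : ahlfors_regular X g.

Let pg : pregauge g. Proof. by case: gg. Qed.

Local Notation dX := (diam [set: X]).

Definition separated (s : R) (l : seq X) : Prop :=
  uniq l /\ {in l &, forall y z, y != z -> s <= mdist y z}.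

Lemma separated_size_le : exists2 C : R, 0 < C & forall (y : X) r s l,
  0 < r <= dX -> 0 < s <= dX -> separated s l ->
  {in l, forall z, ball z (s / 3) `<=` ball y r} ->
  (size l)%:R * g s <= C * g r.
Proof.
have [C C0 XC] := Xregular.
have [D D0 gD] := pregauge_doubling 2 dX pg.
exists (4 * D * C ^+ 2) => [|y r s l rX /andP[s0 sX] [ul sepl] ly].
  by rewrite !mulr_gt0 ?exprn_gt0.
have [r0 rdX] := andP rX.
have s30 : 0 < s / 3 by rewrite divr_gt0.
have gs3 : 0 < g (s / 3) by exact: pregauge_gt0.
have gr : 0 < g r by exact: pregauge_gt0.
pose a := C^-1 * g (s / 3) / 2.
have a0 : 0 < a by rewrite divr_gt0 ?mulr_gt0 ?invr_gt0.
have [eta [eta0 etas etaP]] : exists eta : R, [/\ 0 < eta, eta < s / 3 &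
    {in l, forall z, a%:E < hausdorff_pre g eta%:E (ball z (s / 3))}%E].
  have : \forall eta \near (0 : R)^'+,
      forall z : seq_sub l, (a%:E < hausdorff_pre g eta%:E (ball (val z) (s / 3)))%E.
    apply: filter_forall => z; apply: lt_hausdorff_measure.
    have s3X : 0 < s / 3 <= dX by rewrite s30/=; lra.
    have /andP[+ _] := XC (ssval z) _ s3X.
    apply: lt_le_trans; rewrite lte_fin /a ltr_pdivrMr// mulr_natr mulr2n ltrDl.
    by rewrite mulr_gt0 ?invr_gt0.
  move=> near_a; near (0 : R)^'+ => eta; exists eta; split => // z zl.
  by have : forall z : seq_sub l, (a%:E < hausdorff_pre g eta%:E (ball (val z) (s / 3)))%E
    by [near: eta]; move=> /(_ (SeqSub zl)).
have [B [BB Beta yB] Blt] : exists2 B, ball_cover eta%:E (ball y r) B &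
    (\sum_(0 <= k <oo) (g (diam (B k)))%:E < (2 * C * g r)%:E)%E.
  have : (hausdorff_pre g eta%:E (ball y r) < (2 * C * g r)%:E)%E.
    apply: le_lt_trans (hausdorff_pre_le_measure _ _ eta0) _.
    have /andP[_] := XC y r rX; move=> /le_lt_trans; apply.
    by rewrite lte_fin -mulrA ltr_pMl ?mulr_gt0// ltr1n.
  by move=> /ereal_inf_lt[_ [B Bcov <-] Blt]; exists B.
pose G z := [set k | B k `&` ball z (s / 3) !=set0].
have fd0 k : (0 <= (g (diam (B k)))%:E)%E by exact: (fdiam_ge0 bddX).
have aG z : z \in l -> (a%:E <= \esum_(k in G z) (g (diam (B k)))%:E)%E.
  move=> zl; apply: le_trans (ltW (etaP z zl)) _.
  pose B' k := if k \in G z then B k else set0.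
  rewrite esum_mkcond; apply: ereal_inf_lbound; exists B'.
    split=> [k|k|w zw].
    - by rewrite /B'; case: ifP => // _; left.
    - by rewrite /B'; case: ifP => // _; rewrite diam0 lee_fin ltW.
    - have [k _ Bkw] := yB w (ly z zl w zw); exists k => //.
      by rewrite /B' ifT// inE; exists w.
  have [_ g0 _] := gg.
  rewrite nneseries_esumT => [|k]; last exact: (fdiam_ge0 bddX).
  by apply: eq_esum => k _; rewrite /B'; case: ifP => // _; rewrite diam0 g0.
have : (\esum_(z in [set` l]) a%:E <= (2 * C * g r)%:E)%E.
  apply: le_trans _ (ltW Blt); rewrite nneseries_esumT//.
  apply: le_trans (le_esum aG) _; apply: esum_disjoint_le => // z z' k zl z'l.
  move=> [w [Bkw /mball zw]] [w' [Bkw' /mball zw']]; apply: contrapT => /eqP.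
  move=> /(sepl z z' zl z'l).
  have := Beta k; rewrite lee_fin; have := mdist_le_diam bddX Bkw Bkw'.
  have := metric_triangle z w z'; have := metric_triangle w w' z'.
  by rewrite (metric_sym w'); lra.
rewrite esum_seq//; last by move=> _; rewrite lee_fin ltW.
rewrite sumEFin lee_fin big_const_seq count_predT iter_addr_0 => Nle.
have gs : g s <= D * g (s / 3).
  apply: le_trans _ (gD _ _); last by rewrite s30/=; lra.
  by rewrite pregauge_le ?ltW//; rewrite expr2; lra.
apply: (@le_trans _ _ ((size l)%:R * (D * g (s / 3)))).
  by rewrite ler_wpM2l.
have -> : (size l)%:R * (D * g (s / 3)) = 2 * D * C * (a *+ size l).
  by rewrite /a -mulr_natr; field; rewrite gt_eqF.
rewrite (_ : 4 * D * _ * _ = 2 * D * C * (2 * C * g r)); last by ring.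
by rewrite ler_pM2l ?mulr_gt0.
Unshelve. all: by end_near. Qed.

Lemma covering_size_ge : exists2 C : R, 0 < C & forall (x : X) r, 0 < r <= dX ->
  exists2 s0 : R, 0 < s0 & forall (s : R) (l : seq X), 0 < s <= s0 ->
    (forall y, ball x r y -> exists2 z, z \in l & mdist z y < s) ->
    g r <= C * ((size l)%:R * g s).
Proof.
have [C C0 XC] := Xregular.
have [D D0 gD] := pregauge_doubling 1 dX pg.
exists (2 * C * D) => [|x r rX]; first by rewrite !mulr_gt0.
have [r0 rdX] := andP rX.
have gr : 0 < g r by exact: pregauge_gt0.
have [eta [eta0 etadX etaP]] : exists eta : R, [/\ 0 < eta, eta <= dX &
    ((C^-1 * g r / 2)%:E < hausdorff_pre g eta%:E (ball x r))%E].
  have : \forall eta \near (0 : R)^'+,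
      ((C^-1 * g r / 2)%:E < hausdorff_pre g eta%:E (ball x r))%E.
    apply: lt_hausdorff_measure; have /andP[+ _] := XC x r rX.
    apply: lt_le_trans; rewrite lte_fin ltr_pdivrMr// mulr_natr mulr2n ltrDl.
    by rewrite mulr_gt0 ?invr_gt0.
  move=> near_a; near (0 : R)^'+ => eta; exists eta; split => //.
    by near: eta; apply: nbhs_right_le; lra.
  by near: eta.
exists (eta / 2) => [|s l /andP[s0 seta] xl]; first by rewrite divr_gt0.
have [_ g0 _] := gg.
pose B k := if (k < size l)%N then ball (nth x l k) s else set0.
have : (hausdorff_pre g eta%:E (ball x r) <= ((size l)%:R * (D * g s))%:E)%E.
  apply: (@le_trans _ _ (\sum_(0 <= k <oo) (g (diam (B k)))%:E)%E).
    apply: ereal_inf_lbound; exists B => //; split=> [k|k|y /xl[z zl zy]].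
    - by rewrite /B; case: ifP => _; [right; exact: ball_is_ball|left].
    - rewrite /B lee_fin; case: ifP => _; last by rewrite diam0 ltW.
      by rewrite (le_trans (diam_ball _ (ltW s0)))//; lra.
    - exists (index z l) => //; rewrite /B index_mem zl nth_index//.
      exact/mball.
  rewrite (nneseries_split _ (size l)); last first.
    by move=> k _; exact: (fdiam_ge0 bddX).
  rewrite add0n [X in (_ + X)%E]eseries0 ?adde0 => [|k lk _]; last first.
    by rewrite /B ltnNge lk diam0 g0.
  rewrite sumEFin lee_fin.
  apply: le_trans (_ : \sum_(0 <= k < size l) D * g s <= _); last first.
    by rewrite big_const_nat subn0 iter_addr_0 mulr_natl.
  rewrite big_nat [leRHS]big_nat; apply: ler_sum => k /andP[_ kl].
  rewrite /B kl; apply: le_trans _ (gD _ _); last by rewrite s0/=; lra.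
  by rewrite pregauge_le ?(diam_ge0 bddX)// expr1 diam_ball// ltW.
move=> /(lt_le_trans etaP); rewrite lte_fin ltr_pdivrMr// -ltr_pdivlMl ?invr_gt0//.
rewrite invrK => /ltW/le_trans; apply.
by rewrite le_eqVlt; apply/orP; left; apply/eqP; ring.
Unshelve. all: by end_near. Qed.

Lemma exists_net (K : set X) (s : R) (M : nat) : 0 < s ->
  (forall l, separated s l -> {in l, forall z, K z} -> (size l <= M)%N) ->
  exists l, [/\ separated s l, {in l, forall z, K z} &
    forall y, K y -> exists2 z, z \in l & mdist z y < s].
Proof.
move=> s0 sepM.
pose P n := `[< exists l, [/\ separated s l, {in l, forall z, K z} & size l = n] >].
have P0 : exists n, P n by exists 0%N; apply/asboolP; exists [::].
have PM n : P n -> (n <= M)%N by move=> /asboolP[l [sl lK <-]]; exact: sepM.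
have [n /asboolP[l [[ul sl] lK ln]] maxn] := ex_maxnP P0 PM.
exists l; split => // y Ky; apply: contrapT => far.
have yfar z : z \in l -> s <= mdist z y.
  by move=> zl; rewrite leNgt; apply/negP => lt; apply: far; exists z.
suff : P n.+1 by move=> /maxn; rewrite ltnn.
apply/asboolP; exists (y :: l); split; last by rewrite /= ln.
- split.
    rewrite /= ul andbT; apply/negP => /yfar.
    by rewrite mdistxx leNgt s0.
  move=> u v; rewrite !inE => /predU1P[->|ul'] /predU1P[->|vl] uv.
  + by rewrite eqxx in uv.
  + by rewrite metric_sym yfar.
  + exact: yfar.
  + exact: sl.
- by move=> z; rewrite inE => /predU1P[->//|]; exact: lK.
Qed.

(* By compactness finitely many of the sets matter, and at a scale s below all
   of their diameters the points of an s-net act as a uniform measure. *)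
Lemma weighted_cover_ge : compact [set: X] -> exists2 c : R, 0 < c &
  forall (x : X) r T (a rho : nat -> R) (Q : (set X)^nat), 0 < r <= dX ->
    (forall k, 0 <= a k) -> (forall k, 0 <= rho k) ->
    (forall k, Q k !=set0 -> 0 < rho k) -> (forall k, open (Q k)) ->
    (forall k y z, Q k y -> Q k z -> mdist y z <= rho k) ->
    (forall z, ball x r z -> (T%:E <= \sum_(0 <= k <oo) (a k * \1_(Q k) z)%:E)%E) ->
    ((c * T * g r)%:E <= \sum_(0 <= k <oo) (a k * g (rho k))%:E)%E.
Proof.
move=> cX; have [C1 C10 sepP] := separated_size_le.
have [C2 C20 covP] := covering_size_ge.
have [D D0 gD] := pregauge_doubling 1 dX pg.
exists (2 * D * C2 * (C1 * D))^-1 => [|x r T a rho Q rX a0 rho0 rhogt0 oQ Qrho QT].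
  by rewrite invr_gt0 !mulr_gt0.
have [r0 rdX] := andP rX.
have gr : 0 < g r by exact: pregauge_gt0.
have ag0 k : (0 <= (a k * g (rho k))%:E)%E by rewrite lee_fin mulr_ge0// pregauge_ge0.
have [T0|T0] := leP T 0.
  apply: (@le_trans _ _ 0%E); last exact: nneseries_ge0.
  by rewrite lee_fin pmulr_lle0// pmulr_rle0// invr_gt0 !mulr_gt0.
have aQ0 k z : 0 <= a k * \1_(Q k) z by rewrite mulr_ge0// indicE.
pose W n := [set z | T / 2 < \sum_(k < n) a k * \1_(Q k) z].
pose K := [set z | mdist x z <= r / 2].
have cK : compact K.
  apply: (subclosed_compact _ cX) => //.
  rewrite -[K]setCK; apply: open_closedC; rewrite openE => z /negP; rewrite -ltNge => zr.
  apply/nbhs_ballP; exists (mdist x z - r / 2) => /=; first by rewrite subr_gt0.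
  move=> w /mball zw /=; apply/negP; rewrite -ltNge.
  by have := metric_triangle x w z; rewrite (metric_sym w); lra.
have [n|m n mn z|z Kz|n KW] := compact_ascending cK (W := W).
- rewrite openE => z Wz.
  have : \forall w \near z, forall k : 'I_n, Q k z -> Q k w.
    apply: filter_forall => k; have [Qkz|nQkz] := pselect (Q k z).
      by apply: filterS (open_nbhs_nbhs (conj (oQ k) Qkz)) => w Qkw.
    by near=> w.
  rewrite /interior; apply: filterS => w Qzw; apply: lt_le_trans Wz _.
  apply: ler_sum => k _; rewrite ler_wpM2l// !indicE ler_nat.
  have [/set_mem/Qzw/mem_set ->//|//] := boolP (z \in Q k).
- rewrite /W /= => /lt_le_trans; apply.
  rewrite -!(big_mkord xpredT (fun k => a k * \1_(Q k) z)).
  by rewrite (big_cat_nat _ mn)//= lerDl sumr_ge0.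
- have zr : ball x r z by apply/mball; rewrite (le_lt_trans Kz)//; lra.
  apply: contrapT => nW.
  have := QT z zr; apply/negP; rewrite -ltNge.
  apply: (@le_lt_trans _ _ (T / 2)%:E); last by rewrite lte_fin; lra.
  apply: lime_le; first by apply: is_cvg_nneseries => k _ _; rewrite lee_fin.
  near=> n; rewrite sumEFin lee_fin leNgt; apply/negP => lt; apply: nW.
  by exists n => //; rewrite /W /= -(big_mkord xpredT (fun k => a k * \1_(Q k) z)).
have r2X : 0 < r / 2 <= dX by apply/andP; split; lra.
have [s0 s00 netP] := covP x (r / 2) r2X.
have [s [s_gt0 ss0 sr2 srho]] : exists s : R, [/\ 0 < s, s <= s0, s <= r / 2 &
    forall k, (k < n)%N -> Q k !=set0 -> s <= rho k].
  elim: (n) => [|m [s [s_gt0 ss0 sr IH]]].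
    exists (Num.min s0 (r / 2)); rewrite lt_min s00 ge_min lexx ge_min lexx orbT.
    by split => //; lra.
  have [Qm|Qm] := pselect (Q m !=set0); last first.
    by exists s; split => // k; rewrite ltnS leq_eqVlt => /predU1P[->//|]; exact: IH.
  exists (Num.min s (rho m)); split.
  - by rewrite lt_min s_gt0 rhogt0.
  - by rewrite ge_min ss0.
  - by rewrite ge_min sr.
  - move=> k; rewrite ltnS leq_eqVlt => /predU1P[-> _|km Qk].
      by rewrite ge_min lexx orbT.
    by rewrite ge_min IH.
have gs : 0 < g s by exact: pregauge_gt0.
have sX : 0 < s <= dX by rewrite s_gt0; lra.
have sizeK l : separated s l -> {in l, forall z, K z} ->
    (size l)%:R * g s <= C1 * g r.
  move=> sl lK; apply: (sepP x) => // z zl; apply: sub_mball.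
  by have := lK z zl; rewrite /K /=; lra.
have [l [sl lK lcov]] : exists l, [/\ separated s l, {in l, forall z, K z} &
    forall y, K y -> exists2 z, z \in l & mdist z y < s].
  apply: (@exists_net _ _ (Num.truncn (C1 * g r / g s))) => // l sl lK.
  have sz0 : 0 <= C1 * g r / g s by rewrite ltW// divr_gt0// mulr_gt0.
  by rewrite truncn_ge_nat// ler_pdivlMr// sizeK.
have gr2 : g (r / 2) <= C2 * ((size l)%:R * g s).
  apply: netP => [|y /mball/ltW]; first by rewrite s_gt0.
  exact: lcov.
have grD : g r <= D * g (r / 2).
  apply: le_trans _ (gD _ _); last by apply/andP; split; lra.
  by rewrite expr1 pregauge_le//; lra.
have cnt k : (k < n)%N ->
    (count (fun z => z \in Q k) l)%:R * g s <= C1 * D * g (rho k).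
  move=> kn; rewrite -size_filter; set lk := [seq z <- l | z \in Q k].
  have [->|lk0] := eqVneq lk [::].
    by rewrite mul0r !mulr_ge0 ?pregauge_ge0// ltW.
  have sk : separated s lk.
    have [ul sl'] := sl; split; first exact: filter_uniq.
    move=> y z; rewrite !mem_filter => /andP[_ yl] /andP[_ zl]; exact: sl'.
  have [y ylk] : exists y, y \in lk.
    by case: (lk) lk0 => // y ? _; exists y; rewrite inE eqxx.
  have Qy : Q k y by move: ylk; rewrite mem_filter => /andP[/set_mem].
  have Qk : Q k !=set0 by exists y.
  have rk := rhogt0 k Qk.
  have [rkr|rrk] := ltP (rho k) (r / 2).
    apply: (@le_trans _ _ (C1 * g (2 * rho k))).
      apply: (sepP y) => //; first by apply/andP; split; lra.
      move=> z; rewrite mem_filter => /andP[/set_mem Qz _]; apply: sub_mball.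
      by have := Qrho k y z Qy Qz; have := srho k kn Qk; lra.
    rewrite -mulrA ler_pM2l//.
    by have := gD (rho k); rewrite expr1; apply; apply/andP; split; lra.
  have lkK : {in lk, forall z, K z}.
    by move=> z; rewrite mem_filter => /andP[_]; exact: lK.
  apply: le_trans (sizeK lk sk lkK) _; rewrite -mulrA ler_pM2l//.
  by apply: le_trans grD _; rewrite ler_pM2l// pregauge_le//; lra.
have sumW : (size l)%:R * (T / 2) <=
    \sum_(k < n) a k * (count (fun z => z \in Q k) l)%:R.
  apply: (@le_trans _ _ (\sum_(z <- l) \sum_(k < n) a k * \1_(Q k) z)).
    have -> : (size l)%:R * (T / 2) = \sum_(z <- l) T / 2.
      by rewrite big_const_seq count_predT iter_addr_0 mulr_natl.
    by rewrite big_seq [leRHS]big_seq; apply: ler_sum => z /lK/KW/ltW.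
  rewrite exchange_big/=; apply: ler_sum => k _.
  rewrite -mulr_sumr ler_wpM2l// -sum1_count natr_sum [leRHS]big_mkcond/=.
  by apply: ler_sum => z _; rewrite indicE; case: (z \in Q k).
apply: (@le_trans _ _ (\sum_(k < n) a k * g (rho k))%:E); last first.
  rewrite -(big_mkord xpredT (fun k => a k * g (rho k))) -sumEFin.
  exact: nneseries_lim_ge.
rewrite lee_fin -mulrA ler_pdivrMl ?mulr_gt0//.
apply: (@le_trans _ _ (T * (D * (C2 * ((size l)%:R * g s))))).
  by rewrite ler_pM2l// (le_trans grD)// ler_pM2l.
rewrite (_ : T * _ = 2 * D * C2 * (g s * ((size l)%:R * (T / 2)))); last by field.
rewrite -[leRHS]mulrA ler_pM2l ?mulr_gt0//.
apply: (@le_trans _ _ (g s * \sum_(k < n) a k * (count (fun z => z \in Q k) l)%:R)).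
  by rewrite ler_pM2l.
rewrite !mulr_sumr; apply: ler_sum => k _.
by rewrite mulrCA [leRHS]mulrCA ler_wpM2l// mulrC cnt.
Unshelve. all: by end_near. Qed.

End AhlforsCounting.

(** * Comparison of dimension functions *)

Section DimensionFunctions.
Context {R : realType}.
Implicit Types f g h : R -> R.

Lemma dimension_function_le f r s : dimension_function f ->
  0 <= r -> r <= s -> f r <= f s.
Proof.
move=> [_ + _ _] r0 rs; apply => //; rewrite in_itv/= andbT//.
exact: le_trans rs.
Qed.

Lemma dimension_function_vanish f : dimension_function f ->
  forall e : R, 0 < e -> exists2 t : R, 0 < t & f t < e.
Proof.
move=> [/continuous_within_itvcyP[_ f0] _ fge0 f00] e e0.
rewrite f00 in f0; near (0 : R)^'+ => t; exists t => //.
rewrite -[f t]ger0_norm ?fge0 ?ltW// -[f t]subr0 distrC.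
near: t; move/cvgrPdist_lt : f0; exact.
Unshelve. all: by end_near. Qed.

Lemma doubling_gauge g : dimension_function g -> doubling g -> gauge g.
Proof.
move=> gdim [D D1 gD]; have [_ _ gge0 g0] := gdim.
have D0 : 0 < D by exact: lt_trans D1.
split => //; last exact: dimension_function_vanish.
split; rewrite ?g0//.
- move=> r r0; rewrite -(pmulr_rgt0 _ D0); apply: le_lt_trans (gD r r0).
  by rewrite gge0// mulr_ge0// ltW.
- by move=> r s; exact: dimension_function_le.
- by move=> L; exists D => // r /andP[/gD/ltW].
Qed.

Lemma dim_le_near_gt h f : dim_le h f ->
  exists2 l : R, 0 < l & \forall r \near (0 : R)^'+, l < h r / f r.
Proof.
move=> [_ [l l0 hfl]].
have [k k0 kl] : exists2 k : R, 0 < k & (k%:E < l)%E.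
  case: l l0 {hfl} => [l| |//]; last by exists 1 => //; exact: ltry.
  rewrite lte_fin => l0; exists (l / 2); first by rewrite divr_gt0.
  by rewrite lte_fin; lra.
exists k => //; apply: (hfl [set x | (k%:E < x)%E]).
by apply: open_nbhs_nbhs; split => //; exact: open_ereal_gt_ereal.
Qed.

Lemma dim_le_gt0 h f : dimension_function h -> pregauge f -> dim_le h f ->
  forall r, 0 < r -> 0 < h r.
Proof.
move=> hdim pf /dim_le_near_gt[l l0 hfl] r r0.
near (0 : R)^'+ => t.
have t0 : 0 < t by [].
have : l < h t / f t by near: t.
rewrite ltr_pdivlMr ?(pregauge_gt0 pf)// => lh.
apply: (@lt_le_trans _ _ (h t)).
  by apply: lt_trans _ lh; rewrite mulr_gt0// (pregauge_gt0 pf).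
by apply: dimension_function_le (ltW t0) _ => //; near: t; exact: nbhs_right_le.
Unshelve. all: by end_near. Qed.

Lemma dim_le_ratio h f L : pregauge f -> (forall r, 0 < r -> 0 < h r) ->
  dim_le h f -> exists2 k : R, 0 < k &
  forall s r, 0 < s -> s <= r -> r <= L -> k * f s * h r <= h s * f r.
Proof.
move=> pf h0 hf; have [l l0 hfl] := dim_le_near_gt hf.
have f0 r : 0 < r -> 0 < f r by exact: pregauge_gt0.
have [[ndhf|nihf] _] := hf; last first.
  exists 1 => // s r s0 sr _; have r0 := lt_le_trans s0 sr.
  have := nihf s r; rewrite !in_itv/= s0 r0 => /(_ isT isT sr).
  by rewrite ler_pdivrMr ?f0// mulrAC ler_pdivlMr ?f0// mul1r mulrC (mulrC (h s)).
have [L0|L0] := leP L 0.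
  by exists 1 => // s r s0 sr rL; have := lt_le_trans s0 (le_trans sr rL); rewrite ltNge L0.
have M0 : 0 < h L / f L by rewrite divr_gt0 ?h0 ?f0.
exists (l / (h L / f L)) => [|s r s0 sr rL]; first exact: divr_gt0.
have r0 := lt_le_trans s0 sr.
have rM : h r <= h L / f L * f r.
  by have := ndhf r L; rewrite !in_itv/= r0 L0 => /(_ isT isT rL); rewrite ler_pdivrMr ?f0.
have sl : l * f s <= h s.
  near (0 : R)^'+ => t.
  have t0 : 0 < t by [].
  have lt : l < h t / f t by near: t.
  have ts : t <= s by near: t; exact: nbhs_right_le.
  have := ndhf t s; rewrite !in_itv/= t0 s0 => /(_ isT isT ts) ht.
  by rewrite -ler_pdivlMr ?f0// ltW// (lt_le_trans lt).
apply: (@le_trans _ _ (l / (h L / f L) * f s * (h L / f L * f r))).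
  by rewrite ler_wpM2l// mulr_ge0 ?ltW ?f0// divr_gt0.
rewrite (_ : _ * _ * _ = l * f s * f r); last first.
  by field; rewrite !gt_eqF ?f0 ?h0.
by rewrite ler_wpM2r// ltW// f0.
Unshelve. all: by end_near. Qed.

Lemma dim_le_gauge f g : dimension_function f -> gauge g -> dim_le f g -> gauge f.
Proof.
move=> fdim [pg _ _] fg; have [_ _ fge0 f0] := fdim.
have fgt0 := dim_le_gt0 fdim pg fg.
split => //; last exact: dimension_function_vanish.
split; rewrite ?f0//; first by move=> r s; exact: dimension_function_le.
move=> L; have [k k0 kfg] := dim_le_ratio (2 * L) pg fgt0 fg.
have [_ _ _ /(_ L)[D D0 gD]] := pg.
exists (D / k) => [|r rL]; first exact: divr_gt0.
have [r0 rL'] := andP rL; have g0 : 0 < g r by exact: pregauge_gt0.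
have : k * g r * f (2 * r) <= f r * g (2 * r) by apply: kfg; lra.
move=> /le_trans/(_ (ler_wpM2l (ltW (fgt0 r r0)) (gD r rL))).
rewrite (_ : f r * (D * g r) = k * g r * (D / k * f r)); last by field; rewrite gt_eqF.
by rewrite ler_pM2l// mulr_gt0.
Qed.

End DimensionFunctions.

Section ContentComparison.
Context {R : realType} {X : metricType R} {L : R}.
Hypothesis bddX : forall x y : X, mdist x y <= L.
Implicit Types (f g h : R -> R) (A U : set X).

Lemma large_in_dim_le h f c r0 : gauge h -> gauge f -> dim_le h f -> 0 < c ->
  exists2 c', 0 < c' &
    forall U, large_in f c r0 U -> large_in h c' r0 U.
Proof.
move=> gh gf hf c0; have [ph h0 _] := gh; have [pf f0 _] := gf.
have [k k0 khf] := dim_le_ratio r0 pf (fun r => pregauge_gt0 ph) hf.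
exists (Num.min 1 (k * c)) => [|U lU x r rr0]; first by rewrite lt_min ltr01 mulr_gt0.
have [rgt0 rler0] := andP rr0.
have hr0 : 0 < h r by exact: pregauge_gt0.
have fr0 : 0 < f r by exact: pregauge_gt0.
apply: content_ge => C CB CU.
have hd0 i : (0 <= (h (diam (C i)))%:E)%E by exact: (fdiam_ge0 bddX).
have [[i ri]|small] := pselect (exists i, r <= diam (C i)).
  apply: (@le_trans _ _ (h (diam (C i)))%:E).
    rewrite lee_fin; apply: (@le_trans _ _ (h r)).
      by rewrite ger_pMl// ge_min lexx.
    by rewrite pregauge_le// ltW.
  rewrite nneseries_esumT// -(@esum_set1 _ _ i (fun i => (h (diam (C i)))%:E))//.
  exact: subset_esum.
apply: (@le_trans _ _ (k * h r / f r * (c * f r))%:E).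
  rewrite lee_fin (_ : k * _ / _ * _ = k * c * h r); last by field; rewrite gt_eqF.
  by rewrite ler_pM2r// ge_min lexx orbT.
apply: (@le_trans _ _ ((k * h r / f r)%:E * \sum_(0 <= i <oo) (f (diam (C i)))%:E)%E).
  rewrite EFinM; apply: lee_wpmul2l.
    by rewrite lee_fin divr_ge0 ?mulr_ge0 ?ltW.
  exact: le_trans (lU x r rr0) (le_content f CB CU).
rewrite -nneseriesZl => [|i _]; last exact: (fdiam_ge0 bddX).
apply: lee_nneseries => [i _ _|i _].
  by rewrite -EFinM lee_fin mulr_ge0 ?divr_ge0 ?mulr_ge0 ?pregauge_ge0 ?(diam_ge0 bddX) ?ltW.
rewrite -EFinM lee_fin mulrAC ler_pdivrMr//.
have := diam_ge0 bddX (C i); rewrite le_eqVlt => /predU1P[<-|d0].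
  by rewrite f0 h0 mulr0 mul0r.
rewrite mulrAC; apply: khf => //.
by rewrite leNgt; apply/negP => rd; apply: small; exists i; exact: ltW.
Qed.

Lemma large_class_of_large_in h A c r0 : gauge h -> 0 < c -> 0 < r0 -> 0 < L ->
  Gdelta A -> large_in h c r0 A -> large_class X h A.
Proof.
move=> gh c0 r00 L0 GA lA; have [ph h0 _] := gh.
have [D D0 hD] := pregauge_doubling 1 r0 ph.
have hL : 0 < h L by exact: pregauge_gt0.
have hr0 : 0 < h r0 by exact: pregauge_gt0.
split => //; pose c' := Num.min (c / (2 * D)) (c * h r0 / (2 * h L)).
have c'0 : 0 < c' by rewrite lt_min !divr_gt0 ?mulr_gt0.
exists c' => // _ [x [r [rgt0 ->]]].
have c'B t : (h (diam (ball x r)) <= t) ->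
    (c'%:E * hausdorff_content h (ball x r) <= (c' * t)%:E)%E.
  move=> dt; rewrite EFinM; apply: lee_wpmul2l; first by rewrite lee_fin ltW.
  by apply: le_trans (content_diam bddX gh (ball_is_ball x rgt0)) _; rewrite lee_fin.
have [rr0|r0r] := leP r r0.
  have hr : 0 < h r by exact: pregauge_gt0.
  apply: (@lt_le_trans _ _ (c * h r)%:E); last by apply: lA; rewrite rgt0.
  apply: (@le_lt_trans _ _ (c' * (D * h r))%:E).
    apply: c'B; apply: le_trans _ (hD _ _); last by rewrite rgt0.
    by rewrite pregauge_le ?(diam_ge0 bddX)// expr1 diam_ball// ltW.
  rewrite lte_fin; apply: (@le_lt_trans _ _ (c / (2 * D) * (D * h r))).
    by rewrite ler_pM2r ?mulr_gt0// ge_min lexx.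
  have -> : c / (2 * D) * (D * h r) = c * h r / 2 by field; rewrite gt_eqF.
  by have := mulr_gt0 c0 hr; lra.
apply: (@lt_le_trans _ _ (c * h r0)%:E); last first.
  apply: le_trans (_ : (_ <= hausdorff_content h (A `&` ball x r0))%E) _.
    by apply: lA; rewrite r00/=.
  apply: content_mono; apply: setIS; apply: sub_mball.
  by rewrite mdistxx add0r ltW.
apply: (@le_lt_trans _ _ (c' * h L)%:E).
  apply: c'B; apply: pregauge_le => //; first exact: diam_ge0 bddX _.
  by apply: diam_le => //; exact: ltW.
rewrite lte_fin; apply: (@le_lt_trans _ _ (c * h r0 / (2 * h L) * h L)).
  by rewrite ler_pM2r// ge_min lexx orbT.
have -> : c * h r0 / (2 * h L) * h L = c * h r0 / 2 by field; rewrite gt_eqF.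
by have := mulr_gt0 c0 hr0; lra.
Qed.

Lemma large_class_diam_gt0 f A (B : set X) : gauge f -> large_class X f A ->
  is_ball B -> 0 < diam B.
Proof.
move=> gf [_ [c c0 /(_ B)lA]] BB; have [pf f0 _] := gf.
rewrite lt_neqAle (diam_ge0 bddX) andbT; apply/eqP => d0.
have := lA BB; apply/negP; rewrite -leNgt.
apply: (@le_trans _ _ 0%E); last first.
  by apply: mule_ge0; [rewrite lee_fin ltW|exact: (content_ge0 bddX)].
rewrite -[0%E]/(0%:E) -f0 d0; apply: le_trans _ (content_diam bddX gf BB).
by apply: content_mono => x [].
Qed.

Lemma large_class_large_in f g A : compact [set: X] -> gauge g -> gauge f ->
  ahlfors_regular X g -> dim_le f g -> large_class X f A ->
  exists2 c, 0 < c & large_in f c (diam [set: X]) A.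
Proof.
move=> cX gg gf Xreg fg fA; have [pg _ _] := gg; have [pf _ _] := gf.
have [c1 c10 c1P] := weighted_cover_ge bddX gg Xreg cX.
have lT : large_in g c1 (diam [set: X]) [set: X].
  move=> x r rX; rewrite setTI; apply: content_ge => C CB CU.
  have := c1P x r 1 (fun=> 1) (fun k => diam (C k)) C rX.
  rewrite mulr1; under [X in (_ <= X)%E]eq_eseriesr do rewrite mul1r.
  apply => //.
  - by move=> k; exact: diam_ge0 bddX _.
  - move=> k [z Cz]; have [C0|] := CB k; last exact: large_class_diam_gt0 fA.
    by rewrite C0 in Cz.
  - by move=> k; have [->|[a [s [_ ->]]]] := CB k; [exact: open0|exact: mball_open].
  - by move=> k y z Cy Cz; exact: (mdist_le_diam bddX).
  - move=> z /CU[k _ Ckz].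
    rewrite nneseries_esumT => [|i]; last by rewrite lee_fin mul1r indicE.
    apply: (@le_trans _ _ (\esum_(i in [set k]) (1 * \1_(C i) z)%:E)%E); last first.
      exact: subset_esum.
    by rewrite esum_set1 ?lee_fin mul1r indicE// mem_set.
have [c2 c20 /(_ _ lT)lT2] := large_in_dim_le (diam [set: X]) gf gg fg c10.
have [_ [c c0 cP]] := fA; exists (c * c2) => [|x r rX]; first exact: mulr_gt0.
have [r0 _] := andP rX.
apply: le_trans _ (ltW (cP _ (ball_is_ball x r0))).
rewrite -mulrA EFinM; apply: lee_wpmul2l; first by rewrite lee_fin ltW.
by have := lT2 x r rX; rewrite setTI.
Qed.

End ContentComparison.

(** * Products *)

Section MaxProduct.
Context {R : realType} {d : nat} {Y : 'I_d -> metricType R}.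
Implicit Types (x y z : max_prod Y) (i j : 'I_d).

Lemma max_mball x r y : 0 < r ->
  ball x r y <-> forall i, ball (x i) r (y i).
Proof.
move=> r0; split => [/mball xyr i|xyr].
  by apply/mball; apply: le_lt_trans (mdist_le_max_dist x y i) xyr.
apply/mball; rewrite /mdist/= /max_dist; apply/bigmax_ltP; split => // i _.
exact/mball.
Qed.

Lemma compact_max_prod : (forall i, compact [set: Y i]) ->
  compact [set: max_prod Y].
Proof.
move=> cY F FF _.
have [|p [_ clp]] := tychonoff cY FF; first exact: filterE.
exists p; split => // A B FA /nbhs_ballP[r /= r0 pB].
have [|y [Ay By]] := clp A (fun y : forall i, Y i => forall i, ball (p i) r (y i)) FA.
  apply: (@filter_forall _ _ (fun i y => ball (p i) r (y i)) _ (nbhs_filter p)) => i.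
  exact: (@proj_continuous _ (fun i => Y i : topologicalType) i p _ (nbhsx_ballx _ _ r0)).
by exists y; split => //; apply: pB; apply/max_mball.
Qed.

Lemma max_prod_eval_continuous i : continuous (fun y : max_prod Y => y i).
Proof.
move=> x A /nbhs_ballP[r /= r0 xA]; apply/nbhs_ballP; exists r => //= y.
by move=> /(max_mball _ _ r0)/(_ i)/xA.
Qed.

Lemma dfwith_mball x z r i (w : Y i) : 0 < r -> ball x r z -> ball (x i) r w ->
  ball x r (dfwith z i w : max_prod Y).
Proof.
move=> r0 /(max_mball _ _ r0) xz xw; apply/(max_mball _ _ r0) => j.
by have [<-|ij] := eqVneq i j; rewrite ?dfwithin ?dfwithout.
Qed.

Lemma mdist_dfwith z i (v w : Y i) :
  mdist v w <= mdist (dfwith z i v : max_prod Y) (dfwith z i w : max_prod Y).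
Proof.
have := mdist_le_max_dist (dfwith z i v : max_prod Y) (dfwith z i w) i.
by rewrite !dfwithin.
Qed.

Lemma eval_mball x r i : 0 < r -> [set y i | y in ball x r] = ball (x i) r.
Proof.
move=> r0; apply/seteqP; split => [_ [y /(max_mball _ _ r0) xy <-]//|w xw].
exists (dfwith x i w); last exact: dfwithin.
by apply: dfwith_mball => //; exact: mball_center.
Qed.

Lemma tildeE (f g : 'I_d -> R -> R) i r :
  tilde f g i r = f i r * \prod_(j < d | j != i) g j r.
Proof.
rewrite /tilde (bigD1 i)//= eqxx; congr (_ * _).
by apply: eq_bigr => j /negbTE ->.
Qed.

Lemma tilde_gauge (f g : 'I_d -> R -> R) i :
  gauge (f i) -> (forall j, pregauge (g j)) -> gauge (tilde f g i).
Proof.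
move=> gf pg; have -> : tilde f g i =
    (fun r => f i r * \prod_(j < d | j != i) g j r).
  by apply/funext => r; exact: tildeE.
apply: gaugeM => //.
elim: (index_enum _) => [|j s IH].
  rewrite (_ : (fun _ => _) = fun=> 1); first exact: pregauge1.
  by apply/funext => r; rewrite big_nil.
rewrite (_ : (fun _ => _) = if j != i
    then fun r => g j r * \prod_(k <- s | k != i) g k r
    else fun r => \prod_(k <- s | k != i) g k r).
  by case: ifP => // _; exact: pregaugeM.
by apply/funext => r; rewrite big_cons; case: ifP.
Qed.

(* Slicing: for fixed coordinates z j with j <> i, the slices of a cover of
   U x prod_(j <> i) B(x j, r) form a cover of U; integrating the resulting
   inequality successively over the coordinates j <> i amounts to
   weighted_cover_ge in each of them. *)
Lemma product_content_ge (f g : 'I_d -> R -> R) i (L r0 : R) :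
  (forall x y, mdist x y <= L) ->
  (forall j, compact [set: Y j]) -> (forall j, gauge (g j)) ->
  (forall j, ahlfors_regular (Y j) (g j)) -> gauge (f i) ->
  (forall (u : Y i) s, 0 < s -> 0 < diam (ball u s)) ->
  (forall j, r0 <= diam [set: Y j]) ->
  exists2 c : R, 0 < c & forall (U : set (Y i)) (T : R) x r, 0 < r <= r0 ->
    (T%:E <= hausdorff_content (f i) (U `&` ball (x i) r))%E ->
    ((c * T * \prod_(j < d | j != i) g j r)%:E <=
      hausdorff_content (tilde f g i) ([set y : max_prod Y | U (y i)] `&` ball x r))%E.
Proof.
move=> bddP cY gg Yreg gf perfect r0Y.
have bddY j : exists L', forall u v : Y j, mdist u v <= L'.
  by have [L' _ ?] := compact_mdist_bounded (cY j); exists L'.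
have /choice[c cP] : forall j, exists c : R, 0 < c /\
    forall (x : Y j) r T (a rho : nat -> R) (Q : (set (Y j))^nat), 0 < r <= r0 ->
    (forall k, 0 <= a k) -> (forall k, 0 <= rho k) ->
    (forall k, Q k !=set0 -> 0 < rho k) -> (forall k, open (Q k)) ->
    (forall k (u v : Y j), Q k u -> Q k v -> mdist u v <= rho k) ->
    (forall u, ball x r u -> (T%:E <= \sum_(0 <= k <oo) (a k * \1_(Q k) u)%:E)%E) ->
    ((c * T * g j r)%:E <= \sum_(0 <= k <oo) (a k * g j (rho k))%:E)%E.
  move=> j; have [L' bddj] := bddY j.
  have [c c0 H] := weighted_cover_ge bddj (gg j) (Yreg j) (cY j).
  exists c; split => // x r T a rho Q /andP[r_gt0 rr0]; apply: H.
  by rewrite r_gt0 (le_trans rr0).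
exists (\prod_(j < d | j != i) c j) => [|U T x r rr0 UT].
  by apply: prodr_gt0 => j _; have [] := cP j.
have [r_gt0 _] := andP rr0.
apply: content_ge => C CB CU.
have [pf f0 _] := gf.
pose rho k := diam (C k).
have rho_ge0 k : 0 <= rho k by exact: diam_ge0 bddP _.
have rho_gt0 k : C k !=set0 -> 0 < rho k.
  move=> [z]; rewrite /rho; have [->//|[a [s [s0 ->]]] _] := CB k.
  apply: (@lt_le_trans _ _ (diam (ball (a i) s))); first exact: perfect.
  apply: diam_le; first exact: diam_ge0 bddP _.
  move=> u v au av; apply: le_trans (mdist_dfwith a u v) _.
  by apply: (mdist_le_diam bddP); apply: dfwith_mball => //; exact: mball_center.
pose Q j k : set (Y j) := [set y j | y in C k].
have oQ j k : open (Q j k).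
  rewrite /Q; have [->|[a [s [s0 ->]]]] := CB k; first by rewrite image_set0; exact: open0.
  by rewrite eval_mball//; exact: mball_open.
have slice z : ball x r z -> (T%:E <= \sum_(0 <= k <oo)
    (f i (rho k) * [forall j, (j != i) ==> `[< Q j k (z j) >] ]%:R)%:E)%E.
  move=> xz; apply: le_trans UT _.
  pose S k : set (Y i) := [set u | C k (dfwith z i u)].
  have SB : ball_family S.
    move=> k; rewrite /S; have [->|[a [s [s0 ->]]]] := CB k.
      by left; apply/seteqP; split.
    have [zj|zj] := pselect (forall j, j != i -> ball (a j) s (z j)).
      right; exists (a i), s; split => //; apply/seteqP; split => [u|u au].
        by move=> /(max_mball _ _ s0)/(_ i); rewrite dfwithin.
      apply/(max_mball _ _ s0) => j; have [<-|ij] := eqVneq i j.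
        by rewrite dfwithin.
      by rewrite dfwithout//; apply: zj; rewrite eq_sym.
    left; apply/seteqP; split => // u /(max_mball _ _ s0) uj; apply: zj => j ji.
    by have := uj j; rewrite dfwithout// eq_sym.
  apply: le_trans (le_content _ SB _) _.
    move=> u [Uu xu]; have [|k _ Cku] := CU (dfwith z i u); last by exists k.
    by split; [rewrite /= dfwithin|exact: dfwith_mball].
  have [L' bddi] := bddY i.
  apply: lee_nneseries => [k _ _|k _]; first exact: (fdiam_ge0 bddi).
  rewrite lee_fin; have [->|/set0P[u Sku]] := eqVneq (S k) set0.
    by rewrite diam0 f0 mulr_ge0// pregauge_ge0.
  have -> : [forall j, (j != i) ==> `[< Q j k (z j) >] ].
    apply/forallP => j; apply/implyP => ji; apply/asboolP.
    by exists (dfwith z i u) => //; rewrite dfwithout// eq_sym.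
  rewrite mulr1 pregauge_le ?(diam_ge0 bddi)//; apply: diam_le => // v w Sv Sw.
  by apply: le_trans (mdist_dfwith z v w) _; exact: (mdist_le_diam bddP).
have slice_seq (s : seq 'I_d) : uniq s -> i \notin s -> forall z, ball x r z ->
    ((\prod_(j <- s) (c j * g j r) * T)%:E <= \sum_(0 <= k <oo)
    (f i (rho k) * \prod_(j <- s) g j (rho k) *
      [forall j, (j != i) && (j \notin s) ==> `[< Q j k (z j) >] ]%:R)%:E)%E.
  elim: s => [_ _ z xz|j0 s IH /= /andP[j0s us]].
    rewrite big_nil mul1r; apply: le_trans (slice z xz) _.
    rewrite le_eqVlt; apply/orP; left; apply/eqP; apply: eq_eseriesr => k _.
    rewrite big_nil mulr1; congr (_ * _)%:E; congr (nat_of_bool _)%:R.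
    by apply: eq_forallb => j; rewrite andbT.
  rewrite inE negb_or => /andP[ij0 is_] z xz.
  pose a k := f i (rho k) * \prod_(j <- s) g j (rho k) *
    [forall j, (j != i) && (j \notin j0 :: s) ==> `[< Q j k (z j) >] ]%:R.
  have [_ /(_ (x j0) r (\prod_(j <- s) (c j * g j r) * T) a rho (Q j0) rr0)] := cP j0.
  rewrite big_cons (_ : c j0 * (_ * T) * g j0 r = c j0 * g j0 r *
    \prod_(j <- s) (c j * g j r) * T); last by ring.
  rewrite (_ : (\sum_(0 <= k <oo) (a k * g j0 (rho k))%:E)%E = \sum_(0 <= k <oo)
    (f i (rho k) * \prod_(j <- j0 :: s) g j (rho k) *
      [forall j, (j != i) && (j \notin j0 :: s) ==> `[< Q j k (z j) >] ]%:R)%:E)%E; last first.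
    by apply: eq_eseriesr => k _; rewrite /a big_cons; congr EFin; ring.
  have prod_ge0 k : 0 <= \prod_(j <- s) g j (rho k).
    by apply: prodr_ge0 => j _; apply: pregauge_ge0 => //; case: (gg j).
  apply => //.
  - by move=> k; rewrite !mulr_ge0// pregauge_ge0.
  - by move=> k [_ [y Cky _]]; apply: rho_gt0; exists y.
  - move=> k _ _ [u Cu <-] [v Cv <-].
    exact: le_trans (mdist_le_max_dist u v j0) (mdist_le_diam bddP Cu Cv).
  - move=> w xw.
    apply: le_trans (IH us is_ _ (dfwith_mball r_gt0 xz xw)) _.
    apply: lee_nneseries => [k _ _|k _].
      by rewrite lee_fin !mulr_ge0// pregauge_ge0.
    rewrite lee_fin /a -[leRHS]mulrA ler_wpM2l// ?mulr_ge0 ?pregauge_ge0//.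
    rewrite indicE -natrM ler_nat mulnb.
    case: forallP => // H; rewrite lt0b; apply/andP; split.
      apply/forallP => j; apply/implyP; rewrite inE negb_or => /and3P[ji jj0 js].
      by have := H j; rewrite ji js /= dfwithout// eq_sym.
    by have := H j0; rewrite eq_sym ij0 j0s /= dfwithin => /asboolP/mem_set.
have := slice_seq (enum [pred j | j != i]) (enum_uniq _) _ x (mball_center _ r_gt0).
rewrite mem_enum inE eqxx => /(_ isT).
rewrite big_enum/= big_split/= (_ : _ * _ * T = \prod_(j < d | j != i) c j * T *
  \prod_(j < d | j != i) g j r); last by ring.
have G0 k : 0 <= \prod_(j < d | j != i) g j (rho k).
  by apply: prodr_ge0 => j _; apply: pregauge_ge0 => //; case: (gg j).
move=> /le_trans; apply; apply: lee_nneseries => [k _ _|k _].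
  by rewrite lee_fin big_enum/= !mulr_ge0// pregauge_ge0.
by rewrite lee_fin tildeE big_enum/= ler_piMr ?lern1 ?leq_b1// mulr_ge0// pregauge_ge0.
Qed.

End MaxProduct.

Lemma large_in_weaken {R : realType} {X : metricType R} (f : R -> R) c c' r0
    (U V : set X) : pregauge f -> c' <= c -> U `<=` V ->
  large_in f c r0 U -> large_in f c' r0 V.
Proof.
move=> pf cc' UV lU x r /[dup] rr0 /andP[r_gt0 _].
apply: le_trans (le_trans (lU x r rr0) (content_mono _ _)); last exact: setSI.
by rewrite lee_fin ler_wpM2r// ltW// pregauge_gt0.
Qed.

Lemma open_limsup_stage {T : topologicalType} (E : (set T)^nat) N :
  (forall n, open (E n)) -> open (\bigcup_(j in [set j | (N <= j)%N]) E j).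
Proof. by move=> oE; apply: bigcup_open => j _; exact: oE. Qed.

Theorem theorem2p20 (R : realType) (d : nat) (Y : 'I_d -> metricType R)
    (f g : 'I_d -> R -> R) (E : forall i : 'I_d, (set (Y i))^nat)
    (Ycompact : forall i, compact [set: Y i])
    (gdim : forall i, dimension_function (g i))
    (gdoubling : forall i, doubling (g i))
    (Yregular : forall i, ahlfors_regular (Y i) (g i))
    (fdim : forall i, dimension_function (f i))
    (fg : forall i, dim_le (f i) (g i))
    (fgcomp : forall i j, i != j ->
      dim_le (fun r => f i r * g j r) (fun r => f j r * g i r) \/
      dim_le (fun r => f j r * g i r) (fun r => f i r * g j r))
    (Eopen : forall i n, open (E i n))
    (Elarge : forall i, large_class (Y i) (f i) (lim_sup_set (E i))) :
  (forall i, large_class (max_prod Y) (tilde f g i)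
     [set y : max_prod Y | lim_sup_set (E i) (y i)]) /\
  (forall k, (forall i, dim_le (tilde f g k) (tilde f g i)) ->
     large_class (max_prod Y) (tilde f g k)
       [set y : max_prod Y | forall i, lim_sup_set (E i) (y i)]).
Proof.
pose V N i := [set y : max_prod Y |
  (\bigcup_(j in [set j | (N <= j)%N]) E i j) (y i)].
have oV N i : open (V N i).
  apply: open_comp; last exact: open_limsup_stage.
  by move=> y _; exact: max_prod_eval_continuous.
have V_limsup i : [set y : max_prod Y | lim_sup_set (E i) (y i)] = \bigcap_N V N i.
  by [].
pose W m := if unpickle m is Some (N, i) then V N i else setT.
have oW m : open (W m) by rewrite /W; case: unpickle => [[N i]|]//; exact: openT.
have W_limsup : [set y : max_prod Y | forall i, lim_sup_set (E i) (y i)] =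
    \bigcap_m W m.
  apply/seteqP; split => [y yE m _|y yW i N _].
    by rewrite /W; case: unpickle => [[N i]|]//; exact: yE.
  by have := yW (pickle (N, i)) Logic.I; rewrite /W pickleK.
have GV i : Gdelta [set y : max_prod Y | lim_sup_set (E i) (y i)].
  by exists (V ^~ i).
have GW : Gdelta [set y : max_prod Y | forall i, lim_sup_set (E i) (y i)].
  by exists W.
have [[x0 _]|P0] := pselect (exists x : max_prod Y, True); last first.
  by split=> [i|k _]; split => //; exists 1 => // B [x _]; exfalso; apply: P0; exists x.
have gg i : gauge (g i) by exact: doubling_gauge.
have gf i : gauge (f i) by exact: dim_le_gauge (fdim i) (gg i) (fg i).
have gtilde i : gauge (tilde f g i) by apply: tilde_gauge => // j; case: (gg j).
have bddY i : exists L', forall u v : Y i, mdist u v <= L'.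
  by have [L' _ ?] := compact_mdist_bounded (Ycompact i); exists L'.
have perfect i (u : Y i) s : 0 < s -> 0 < diam (ball u s).
  move=> s0; have [L' bddi] := bddY i.
  exact: (large_class_diam_gt0 bddi (gf i) (Elarge i) (ball_is_ball u s0)).
have [L L0 bddP] := compact_mdist_bounded (compact_max_prod Ycompact).
pose r0 : R := \big[Num.min/1]_(i < d) diam [set: Y i].
have r00 : 0 < r0.
  apply: lt_bigmin => // i _; have [L' bddi] := bddY i.
  by apply: lt_le_trans (perfect i (x0 i) 1 ltr01) _; exact: (le_diam bddi).
have r0Y i : r0 <= diam [set: Y i] by exact: bigmin_le.
have lV i : exists2 c, 0 < c &
    large_in (tilde f g i) c r0 [set y : max_prod Y | lim_sup_set (E i) (y i)].
  have [L' bddi] := bddY i.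
  have [c1 c10 lE] := large_class_large_in bddi (Ycompact i) (gg i) (gf i)
    (Yregular i) (fg i) (Elarge i).
  have [c2 c20 prodP] := product_content_ge bddP Ycompact gg Yregular (gf i)
    (perfect i) r0Y.
  exists (c2 * c1) => [|x r rr0]; first exact: mulr_gt0.
  have := prodP (lim_sup_set (E i)) (c1 * f i r) x r rr0.
  rewrite tildeE !mulrA; apply; apply: lE.
  by have [-> /le_trans->] := andP rr0.
split => [i|k fk].
  have [c c0 lc] := lV i.
  exact: (large_class_of_large_in bddP (gtilde i) c0 r00 L0 (GV i) lc).
have /choice[c cP] : forall i, exists c, 0 < c /\ forall N,
    large_in (tilde f g k) c r0 (V N i).
  move=> i; have [c c0 lc] := lV i.
  have [c' c'0 cc'] := large_in_dim_le bddP r0 (gtilde k) (gtilde i) (fk i) c0.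
  exists c'; split => // N; have [pk _ _] := gtilde k.
  apply: large_in_weaken pk (lexx _) _ (cc' _ lc).
  by rewrite V_limsup; exact: bigcap_inf.
pose c0 := \big[Num.min/1]_(i < d) c i.
have c00 : 0 < c0 by apply: lt_bigmin => // i _; have [] := cP i.
have lW m : large_in (tilde f g k) c0 r0 (W m).
  have [pk _ _] := gtilde k; rewrite /W; case: unpickle => [[N i]|].
    by apply: large_in_weaken pk _ _ ((cP i).2 N) => //; exact: bigmin_le.
  by apply: large_in_weaken pk _ _ ((cP k).2 0%N) => //; exact: bigmin_le.
have [e e0 eP] := large_in_bigcap bddP (gtilde k) (compact_max_prod Ycompact) c00 r00.
apply: (large_class_of_large_in bddP (gtilde k) e0 r00 L0 GW).
by rewrite W_limsup; exact: eP.
Qed.
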